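(* Let $0\le w\le k$ and let $t$ be a positive integer. There exists a constant $d_{w,k}(t)$ such that: (1) for every nonempty $\Sigma\subset X_w$, $\frac{1}{|\Sigma|^2}\sum_{S,S'\in\Sigma}|S\cap S'|^t\ge d_{w,k}(t)$; (2) when $w=k$, equality holds if and only if $\Sigma$ is a $t$-design.
   Context: Consider $\mathbb{F}_2^{2k}$ with the nondegenerate quadratic form of maximal Witt index $q(a,b)=a\cdot b$ ($a,b\in\mathbb{F}_2^k$), and its orthogonal group $O^+(2k,2)$. $X_w$ is the set of totally isotropic (i.e. totally singular for $q$) subspaces of dimension $w$; $|S\cap S'|$ is the number of vectors in $S\cap S'$. For $w=k$: under $O^+(2k,2)$ the space of complex-valued functions on $X_k$ decomposes multiplicity-freely as $V_0\oplus V_1\oplus\dots\oplus V_k$ with $V_0$ the constants, where the zonal spherical function of $V_j$ is a polynomial of degree $j$ in $2^{\dim(S\cap S')}$ (the $q$-Krawtchouk ordering). A subset $\Sigma\subset X_k$ is a $t$-design if $\sum_{S\in\Sigma}f(S)=0$ for all $f\in V_j$, $1\le j\le t$ (Delsarte's notion of design in this association scheme). *)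

(* Defs.v *)
From HB Require Import structures.
From mathcomp Require Import all_boot all_order all_algebra.
From mathcomp Require Import complex.
From mathcomp Require Import reals.

Set Implicit Arguments.
Unset Strict Implicit.
Unset Printing Implicit Defensive.

Import Order.TTheory GRing.Theory Num.Theory.
Local Open Scope ring_scope.

Section FiniteVspace.
Import VectorInternalTheory.

HB.instance Definition _ (K : finFieldType) (vT : vectType K) :=
  [Countable of {vspace vT} by <:].
HB.instance Definition _ (K : finFieldType) (vT : vectType K) :=
  [Finite of {vspace vT} by <:].

End FiniteVspace.

Notation vec k := 'rV['F_2]_(k + k).

(* v stands for the pair (a, b) with a = lsubmx v and b = rsubmx v. *)
Definition qform k (v : vec k) : 'F_2 := (lsubmx v *m (rsubmx v)^T) 0 0.

Definition totally_singular k (S : {vspace vec k}) : bool :=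
  [forall v : vec k, (v \in S) ==> (qform v == 0)].

Definition tsing k w : {set {vspace vec k}} :=
  [set S | (\dim S == w) && totally_singular S].

Definition in_Oplus k (g : 'End(vec k)) : Prop :=
  lker g = 0%VS /\ forall v, qform (g v) = qform v.

Definition Xmax k : predArgType := {S : {vspace vec k} | S \in tsing k k}.
HB.instance Definition _ k := SubFinite.on (Xmax k).

Lemma Oplus_tsing k w (g : 'End(vec k)) (S : {vspace vec k}) :
  in_Oplus g -> S \in tsing k w -> (g @: S)%VS \in tsing k w.
Proof.
case=> kg qg; rewrite !inE => /andP[/eqP dS /forallP sS]; apply/andP; split.
  by rewrite limg_dim_eq ?dS // kg capv0.
apply/forallP => v; apply/implyP => /memv_imgP[u uS ->].
by rewrite qg; have /implyP := sS u; apply.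
Qed.

(* The default value of insubd is not reached when g is orthogonal, as
   val_act shows. *)
Definition act k (g : 'End(vec k)) (S : Xmax k) : Xmax k :=
  insubd S (g @: val S)%VS.

Lemma val_act k (g : 'End(vec k)) (S : Xmax k) :
  in_Oplus g -> val (act g S) = (g @: val S)%VS.
Proof. by move=> Og; rewrite val_insubd Oplus_tsing // (valP S). Qed.

Notation Xfun R k := {ffun Xmax k -> R[i]^o}.

Definition actf (R : realType) k (g : 'End(vec k)) (f : Xfun R k) : Xfun R k :=
  [ffun S => f (act g S)].

Definition invariant_sub (R : realType) k (U : {vspace Xfun R k}) : Prop :=
  forall g f, in_Oplus g -> f \in U -> actf g f \in U.

Definition irreducible_sub (R : realType) k (U : {vspace Xfun R k}) : Prop :=
  [/\ U <> 0%VS, invariant_sub U &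
      forall W : {vspace Xfun R k}, (W <= U)%VS -> invariant_sub W ->
        W = 0%VS \/ W = U].

Definition isomorphic_sub (R : realType) k (U W : {vspace Xfun R k}) : Prop :=
  exists T : 'End(Xfun R k),
    [/\ (T @: U)%VS = W, (U :&: lker T)%VS = 0%VS &
        forall g f, in_Oplus g -> f \in U -> T (actf g f) = actf g (T f)].

(* phi is the zonal spherical function of U with pole S0: the element of U
   fixed by the stabilizer of S0 and normalized by phi S0 = 1. *)
Definition zonal_spherical (R : realType) k (U : {vspace Xfun R k})
    (S0 : Xmax k) (phi : Xfun R k) : Prop :=
  [/\ phi \in U, phi S0 = 1 &
      forall g, in_Oplus g -> act g S0 = S0 -> actf g phi = phi].

(* Only meaningful for j <= k: 2 ^ \dim (S :&: S') takes at most k + 1 values,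
   so the degree of p is determined by its values only in that range. *)
Definition zonal_degree (R : realType) k (U : {vspace Xfun R k}) (j : nat) :
    Prop :=
  exists2 p : {poly R[i]}, size p = j.+1 &
    forall S0 : Xmax k, zonal_spherical U S0
      [ffun S => p.[(2 ^ \dim (val S :&: val S0))%:R]].

Definition qKrawtchouk_decomposition (R : realType) k
    (V : 'I_k.+1 -> {vspace Xfun R k}) : Prop :=
  [/\ (\sum_j V j)%VS = fullv /\ directv (\sum_j V j),
      forall j, irreducible_sub (V j),
      forall i j, i != j -> ~ isomorphic_sub (V i) (V j),
      V ord0 = <[ [ffun=> 1] : Xfun R k ]>%VS &
      forall j, zonal_degree (V j) j].

(* There is exactly one such V, so the quantifier merely names its
   components. *)
Definition is_design (R : realType) k (t : nat)
    (Sigma : {set {vspace vec k}}) : Prop :=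
  forall V : 'I_k.+1 -> {vspace Xfun R k}, qKrawtchouk_decomposition V ->
  forall j : 'I_k.+1, (1 <= j <= t)%N ->
  forall f : Xfun R k, f \in V j -> \sum_(S : Xmax k | val S \in Sigma) f S = 0.

Definition mean_energy (R : realType) k (t : nat)
    (Sigma : {set {vspace vec k}}) : R :=
  (\sum_(S in Sigma) \sum_(S' in Sigma)
     (#|[set v : vec k | v \in (S :&: S')%VS]| ^ t)%:R) / #|Sigma|%:R ^+ 2.

(* Main.v *)
From HB Require Import structures.
Require Import Defs.
From mathcomp Require Import all_boot all_order all_algebra.
From mathcomp Require Import fingroup perm finfield zify ring.
From mathcomp Require Import complex.
From mathcomp Require Import boolp reals.

Set Implicit Arguments.
Unset Strict Implicit.
Unset Printing Implicit Defensive.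

Import Order.TTheory GRing.Theory Num.Theory.
Local Open Scope ring_scope.

(* For w < k the bound d = 0 will do.  For w = k let M_t be the operator on
   functions on X_k with kernel |S :&: S'|^t.  Counting t-tuples of vectors,
   <f, M_t f> = sum over tuples tau of |sum_(S containing tau) f S|^2, so M_t is
   positive semidefinite and its kernel consists of the f whose sums over
   {S | U <= S} vanish for every U of dimension at most t; it decreases with t and
   is zero for t >= k.  As the constants are an eigenspace of M_t, the energy of
   Sigma is at least that of X_k, with equality if and only if the centred
   indicator function of Sigma is in ker M_t, i.e. is orthogonal to im M_t.

   Put V_j = im M_j /\ ker M_(j-1), so that im M_t = V_0 + ... + V_t.  All V_j with
   j <= k are nonzero: S |-> [T <= S] (-1)^(dim (S :&: S0)), where dim T = k - j,
   is killed by M_(j-1), because reflections change the parity of dim (S :&: S0), but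
   not by M_j.  By Witt's theorem the functions fixed by the stabilizer of S0 are
   the polynomials in x = 2^(dim (S :&: S0)), and x^i is in im M_i but not in
   im M_(i-1); hence those in V_j are the multiples of one polynomial of degree j.
   This gives irreducibility and pairwise non-isomorphism.  Conversely, in
   any decomposition V with the required zonal functions, V_j meets im M_j,
   hence is contained in it. *)

(** * Row spaces and the polarity of the quadratic form *)

Section RowSpaces.
Variables (F : fieldType) (n : nat).
Implicit Types (U : {vspace 'rV[F]_n}) (v : 'rV[F]_n).

Definition bmx U : 'M[F]_(\dim U, n) := \matrix_i (vbasis U)`_i.

Lemma mem_bmx U v : (v \in U) = (v <= bmx U)%MS.
Proof.
apply/idP/submxP => [vU | [D ->]].
  exists (\row_i coord (vbasis U) i v); rewrite mulmx_sum_row.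
  rewrite {1}(coord_vbasis vU); apply: eq_bigr => i _.
  by rewrite rowK mxE.
rewrite mulmx_sum_row memv_suml // => i _; rewrite rowK memvZ //.
by rewrite vbasis_mem // mem_nth // size_tuple.
Qed.

Lemma row_free_bmx U : row_free (bmx U).
Proof.
apply: inj_row_free => v; rewrite mulmx_sum_row => v0.
have /freeP fU := basis_free (vbasisP U).
apply/rowP => i; rewrite mxE; apply: (fU (fun i => v 0 i)).
by rewrite -[RHS]v0; apply: eq_bigr => j _; rewrite rowK.
Qed.

Lemma rank_bmx U : \rank (bmx U) = \dim U.
Proof. by apply/eqP; rewrite -/(row_free _) row_free_bmx. Qed.

(** The number of rows is a variable [d], so that no cast along [\dim U = d] is needed. *)
Lemma vspace_basis_mx d U : \dim U = d ->
  exists2 P : 'M_(d, n), row_free P & forall v, (v \in U) = (v <= P)%MS.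
Proof. by move=> <-; exists (bmx U); [exact: row_free_bmx | exact: mem_bmx]. Qed.

Lemma dim_mxrank m (M : 'M[F]_(m, n)) U :
  (forall v, (v \in U) = (v <= M)%MS) -> \dim U = \rank M.
Proof.
move=> UM; rewrite -rank_bmx; apply: eqmx_rank; apply/andP; split.
  by apply/row_subP => i; rewrite -UM mem_bmx row_sub.
by apply/row_subP => i; rewrite -mem_bmx UM row_sub.
Qed.

End RowSpaces.

Lemma trmx11 (T : Type) (A : 'M[T]_1) : A^T = A.
Proof. by apply/matrixP => i j; rewrite mxE !ord1. Qed.

Lemma addF2 (x : 'F_2) : x + x = 0.
Proof. by apply: addrr_pchar2; rewrite pchar_Fp. Qed.

Lemma F2_cases (x : 'F_2) : x = 0 \/ x = 1.
Proof.
by case: x => [[|[|m]] lt] //; [left | right]; apply: val_inj.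
Qed.

(** * The polar form, orthogonal complements and reflections *)

Section Polarity.
Variable k : nat.
Implicit Types (u v a : vec k) (S U A C : {vspace vec k}).

Definition polar_mx : 'M['F_2]_(k + k) := block_mx 0 1%:M 1%:M 0.

(** The polar form of [qform], see [qformD]; [polar_mx] is its Gram matrix. *)
Definition bform u v : 'F_2 := (u *m polar_mx *m v^T) 0 0.

Lemma polar_mxK : polar_mx *m polar_mx = 1%:M.
Proof.
by rewrite mulmx_block !mulmx1 !mulmx0 !addr0 !add0r -scalar_mx_block.
Qed.

Lemma polar_mx_tr : polar_mx^T = polar_mx.
Proof. by rewrite tr_block_mx !trmx0 !trmx1. Qed.

Lemma bformC u v : bform u v = bform v u.
Proof.
by rewrite /bform -[_ *m v^T]trmx11 !trmx_mul trmxK polar_mx_tr mulmxA.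
Qed.

Lemma bformE u v : bform u v =
  (lsubmx u *m (rsubmx v)^T) 0 0 + (lsubmx v *m (rsubmx u)^T) 0 0.
Proof.
rewrite /bform -{1}[u]hsubmxK -{1}[v]hsubmxK mul_row_block !mulmx0 !mulmx1.
rewrite addr0 add0r tr_row_mx mul_row_col mxE addrC; congr (_ + _).
by rewrite -[RHS](congr1 (fun A : 'M_1 => A 0 0) (trmx11 _)) trmx_mul trmxK.
Qed.

Lemma bform_rowE m p (A : 'M_(m, k + k)) (B : 'M_(p, k + k)) i j :
  bform (row i A) (row j B) = (A *m polar_mx *m B^T) i j.
Proof. by rewrite /bform -row_mul !mxE; apply: eq_bigr => l _; rewrite !mxE. Qed.

Lemma bformDl u1 u2 v : bform (u1 + u2) v = bform u1 v + bform u2 v.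
Proof. by rewrite /bform !mulmxDl mxE. Qed.
Lemma bformDr u v1 v2 : bform u (v1 + v2) = bform u v1 + bform u v2.
Proof. by rewrite bformC bformDl !(bformC u). Qed.
Lemma bformZl c u v : bform (c *: u) v = c * bform u v.
Proof. by rewrite /bform -!scalemxAl mxE. Qed.
Lemma bformZr c u v : bform u (c *: v) = c * bform u v.
Proof. by rewrite bformC bformZl bformC. Qed.

Lemma qformD u v : qform (u + v) = qform u + qform v + bform u v.
Proof.
rewrite bformE /qform !linearD /= !mulmxDl ?mulmxDr ![(_ + _ : 'M_1) _ _]mxE.
by rewrite [LHS](AC (2*2) (1*4*(3*2))).
Qed.

Lemma qformZ c u : qform (c *: u) = c * (c * qform u).
Proof. by rewrite /qform !linearZ /= -scalemxAl ![(_ *: (_ : 'M_1)) _ _]mxE. Qed.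

Lemma bform_alt u : bform u u = 0.
Proof. by rewrite bformE addF2. Qed.

(** Weaker than total singularity: [max_singular_perp] needs the dimension bound for a subspace that
    may contain nonsingular vectors. *)
Definition isotropic U := forall u v, u \in U -> v \in U -> bform u v = 0.

Lemma totally_singularP U :
  reflect (forall v, v \in U -> qform v = 0) (totally_singular U).
Proof.
apply: (iffP forallP) => sU v; first by move=> vU; apply/eqP; move: (implyP (sU v) vU).
by apply/implyP => /sU ->.
Qed.

Lemma singular_isotropic U : totally_singular U -> isotropic U.
Proof.
move=> /totally_singularP sU u v uU vU; have := sU _ (rpredD uU vU).
by rewrite qformD !sU // !add0r.
Qed.

(** For a basis matrix [B] of [U] and the invertible Gram matrix [J], [B J B^T = 0] forces
    [2 rank B <= 2k]. *)
Lemma isotropic_dim U : isotropic U -> (\dim U <= k)%N.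
Proof.
move=> iU; have : (bmx U *m polar_mx) *m (bmx U)^T = 0.
  apply/matrixP => i j.
  have := iU (row i (bmx U)) (row j (bmx U)).
  rewrite !mem_bmx !row_sub bform_rowE => -> //; by rewrite ?mxE.
move/mulmx0_rank_max; rewrite mxrank_tr mxrankMfree; last first.
  by rewrite row_free_unit; have [] := mulmx1_unit polar_mxK.
by move=> h; rewrite -leq_double -!addnn -{1 2}rank_bmx.
Qed.

(** Otherwise [S + <[v]>] would be isotropic of dimension [k + 1]. *)
Lemma max_singular_perp S v : S \in tsing k k ->
  (forall s, s \in S -> bform v s = 0) -> v \in S.
Proof.
rewrite inE => /andP[/eqP dS sS] vS; apply/negPn/negP => nvS.
have : isotropic (S + <[v]>).
  move=> u1 u2 /memv_addP[s1 s1S [_ /vlineP[c1 ->] ->]].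
  move=> /memv_addP[s2 s2S [_ /vlineP[c2 ->] ->]].
  rewrite !bformDl !bformDr !bformZl !bformZr (bform_alt v) (bformC s1 v) !vS //.
  by rewrite (singular_isotropic sS) // !mulr0 !addr0.
move/isotropic_dim; rewrite dimv_disjoint_sum ?dS ?dim_vline; last first.
  apply/eqP; rewrite -subv0; apply/subvP => x /memv_capP[xS /vlineP[c xc]].
  rewrite memv0 xc; move: xS; rewrite xc rpredZeq.
  case/orP=> [/eqP->|]; first by rewrite scale0r.
  by rewrite (negPf nvS).
by case: eqP nvS => [->|_ _]; rewrite ?mem0v // addn1 ltnn.
Qed.

Definition perp A : {vspace vec k} :=
  lker (linfun (mulmxr (polar_mx *m (bmx A)^T))).

Lemma perpP A v : reflect (forall a, a \in A -> bform v a = 0) (v \in perp A).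
Proof.
rewrite memv_ker lfunE /=; apply: (iffP eqP) => [v0 a | vA].
  rewrite mem_bmx => /submxP[D ->]; rewrite /bform trmx_mul mulmxA.
  by rewrite -(mulmxA v) v0 mul0mx mxE.
apply/rowP => i; have := vA (row i (bmx A)).
rewrite mem_bmx row_sub => /(_ isT); rewrite -{1}(row_id 0 v) bform_rowE.
by rewrite mulmxA => ->; rewrite mxE.
Qed.

Lemma dim_cap_perp C A : (\dim C <= \dim (C :&: perp A) + \dim A)%N.
Proof.
rewrite -(limg_ker_dim (linfun (mulmxr (polar_mx *m (bmx A)^T))) C) leq_add2l.
by apply: leq_trans (dimvS (subvf _)) _; rewrite dimvf dim_matrix mul1r.
Qed.

(** The dimension of [perp U] exceeds [k], so [perp U] is not isotropic, let alone totally
    singular. *)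
Lemma perp_nonsingular U : (\dim U < k)%N ->
  exists2 a, a \in perp U & qform a = 1.
Proof.
move=> dU; have : ~~ totally_singular (perp U).
  apply/negP => /singular_isotropic/isotropic_dim.
  have := dim_cap_perp fullv U; rewrite capfv dimvf dim_matrix mul1r => le1 le2.
  have := leq_trans le1 (leq_add le2 (leqnn _)).
  by rewrite leq_add2l leqNgt dU.
rewrite negb_forall => /existsP[a]; rewrite negb_imply => /andP[aU qa].
by exists a => //; case: (F2_cases (qform a)) qa => // ->; rewrite eqxx.
Qed.

Definition reflection a : 'End(vec k) :=
  linfun (mulmxr (1%:M + polar_mx *m a^T *m a)).

Lemma reflectionE a v : reflection a v = v + bform v a *: a.
Proof.
rewrite lfunE /= mulmxDr mulmx1 !mulmxA; congr (_ + _).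
by rewrite [_ *m a^T]mx11_scalar mul_scalar_mx.
Qed.

Lemma reflectionK a : involutive (reflection a).
Proof.
move=> v; rewrite !reflectionE bformDl bformZl bform_alt mulr0 addr0 -addrA.
by rewrite -scalerDl addF2 scale0r addr0.
Qed.

Lemma Oplus_reflection a : qform a = 1 -> in_Oplus (reflection a).
Proof.
move=> qa; split.
  by apply/eqP/lker0P; apply: can_inj (@reflectionK a).
by move=> v; rewrite reflectionE qformD qformZ bformZr qa mulr1 -addrA addF2 addr0.
Qed.

Lemma reflection_perp a v : bform v a = 0 -> reflection a v = v.
Proof. by rewrite reflectionE => ->; rewrite scale0r addr0. Qed.

(* Both intersections contain [H :&: S0] with codimension at most one, where
   [H] is the part of [S] orthogonal to [a], and exactly one of them is larger: a
   vector [z] of [S0] orthogonal to [H] but not in [H] has the form [z' + b a] with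
   [z'] in [S], and [qform z = 0] forces [b = 0] or [z = reflection a z']. *)
Lemma dim_cap_reflection a S S0 : qform a = 1 -> S \in tsing k k -> S0 \in tsing k k ->
  odd (\dim (reflection a @: S :&: S0)%VS) = ~~ odd (\dim (S :&: S0)%VS).
Proof.
move=> qa; set r := reflection a; set S' := (r @: S)%VS => SX S0X.
have S'X : S' \in tsing k k by apply: Oplus_tsing => //; exact: Oplus_reflection.
have [dS sS] : \dim S = k /\ totally_singular S.
  by move: SX; rewrite inE => /andP[/eqP].
have [dS0 sS0] : \dim S0 = k /\ totally_singular S0.
  by move: S0X; rewrite inE => /andP[/eqP].
have [dS' sS'] : \dim S' = k /\ totally_singular S'.
  by move: S'X; rewrite inE => /andP[/eqP].
have mem_perp v : (v \in perp <[a]>) = (bform v a == 0).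
  apply/perpP/eqP => [-> //| va _ /vlineP[c ->]]; first exact: memv_line.
  by rewrite bformZr va mulr0.
pose H := (S :&: perp <[a]>)%VS.
have HE : (S' :&: perp <[a]>)%VS = H.
  apply/vspaceP => v; rewrite /H !memv_cap !mem_perp.
  case: eqP => [va|]; rewrite ?andbF // !andbT.
  by apply/idP/idP => [/memv_imgP[u uS E]|vS]; last first;
    [rewrite -(reflection_perp va) memv_img | rewrite -(reflection_perp va) E reflectionK].
(* If all of [S] were orthogonal to [a], maximality would put [a] into [S], against
   [qform a = 1]. *)
have aS : exists2 s, s \in S & bform s a = 1.
  have : ~~ (S <= perp <[a]>)%VS.
    apply/negP => /subvP aS.
    have : a \in S.
      apply: max_singular_perp => // s /aS; rewrite mem_perp bformC => /eqP //.
    by move/(totally_singularP _ sS); rewrite qa => /eqP; rewrite oner_eq0.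
  move/subvPn => [s sS1]; rewrite mem_perp => sa; exists s => //.
  by case: (F2_cases (bform s a)) sa => // ->; rewrite eqxx.
have dA : \dim <[a]> = 1%N.
  rewrite dim_vline; case: eqP qa => // -> /eqP.
  by rewrite -(scale0r a) qformZ mul0r eq_sym oner_eq0.
have capH T : (T :&: perp <[a]>)%VS = H -> (T :&: S0 :&: perp <[a]>)%VS = (H :&: S0)%VS.
  by move=> <-; rewrite -!capvA (capvC S0).
have leS : (\dim (S :&: S0) <= \dim (H :&: S0) + 1)%N.
  by have := dim_cap_perp (S :&: S0) <[a]>; rewrite dA (capH S).
have leS' : (\dim (S' :&: S0) <= \dim (H :&: S0) + 1)%N.
  by have := dim_cap_perp (S' :&: S0) <[a]>; rewrite dA (capH S').
have geS : (\dim (H :&: S0) <= \dim (S :&: S0))%N.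
  by apply: dimvS; apply: capvS => //; apply: capvSl.
have geS' : (\dim (H :&: S0) <= \dim (S' :&: S0))%N.
  by apply: dimvS; apply: capvS => //; rewrite -HE; apply: capvSl.
have eqH (T : {vspace vec k}) : (H <= T)%VS -> (\dim (T :&: S0) <= \dim (H :&: S0))%N ->
  (T :&: S0 = H :&: S0)%VS.
  by move=> HT le; apply/eqP; rewrite eq_sym eqEdim le andbT capvS.
have HS : (H <= S)%VS by apply: capvSl.
have HS' : (H <= S')%VS by rewrite -HE; apply: capvSl.
have dH : (k <= \dim H + 1)%N by have := dim_cap_perp S <[a]>; rewrite dA dS.
have dHk : (\dim H < k)%N.
  have := dimvS HS; rewrite dS ltn_neqAle => ->; rewrite andbT; apply/eqP => e.
  have HeS : H = S by apply/eqP; rewrite eqEdim HS dS e leqnn.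
  have [s sS1 s1] := aS; move: sS1; rewrite -HeS memv_cap mem_perp s1.
  by rewrite oner_eq0 andbF.
have n0 : ~ (\dim (S :&: S0) <= \dim (H :&: S0) /\ \dim (S' :&: S0) <= \dim (H :&: S0))%N.
  case=> /(eqH _ HS) e1 /(eqH _ HS') e2.
  (* The left side has dimension at least [k - \dim (H :\: S0)], and [\dim H < k]. *)
  have : ~~ (S0 :&: perp (H :\: S0) <= H :&: S0)%VS.
    apply/negP => /dimvS; apply/negP; rewrite -ltnNge.
    have := dim_cap_perp S0 (H :\: S0); rewrite dS0 => le.
    rewrite -(ltn_add2r (\dim (H :\: S0))) (leq_trans _ le) //.
    by rewrite dimv_cap_compl.
  move/subvPn => [z]; rewrite memv_cap => /andP[zS0 /perpP zH] nz.
  have zperp h : h \in H -> bform z h = 0.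
    move=> hH; have : h \in (H :\: S0 + H :&: S0)%VS by rewrite addv_diff_cap.
    move=> /memv_addP[h1 h1H [h2 /memv_capP[_ h2S0] ->]].
    by rewrite bformDr zH // (singular_isotropic sS0) // addr0.
  (* For [u] in [S], the vector [u + bform u a *: s] lies in [H], hence is orthogonal to [z]; this
     determines the multiple of [a] that makes [z'] orthogonal to [S]. *)
  have [s sS1 s1] := aS; pose z' := z + bform z s *: a.
  have z'S : z' \in S.
    apply: max_singular_perp => // u uS.
    have : u + bform u a *: s \in H.
      rewrite memv_cap mem_perp rpredD ?memvZ //= bformDl bformZl s1 mulr1.
      by rewrite addF2.
    move/zperp; rewrite bformDr bformZr => /eqP; rewrite addr_eq0 => /eqP zu.
    rewrite bformDl bformZl zu (bformC a) mulrC addrC.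
    by rewrite mulrC subrr.
  have zz' : z = z' + bform z s *: a by rewrite -addrA -scalerDl addF2 scale0r addr0.
  have qz : qform z = 0 by apply: (totally_singularP _ sS0).
  case: (F2_cases (bform z s)) => zs.
    move: nz; rewrite -e1 memv_cap zS0 andbT.
    by move: z'S; rewrite /z' zs scale0r addr0 => ->.
  move: qz; rewrite zz' zs scale1r qformD (totally_singularP _ sS _ z'S) qa add0r => /eqP.
  rewrite addr_eq0 => z'a; move: nz; rewrite -e2 memv_cap zS0 andbT.
  suff -> : z = r z' by rewrite memv_img.
  rewrite reflectionE {1}zz' zs; congr (_ + _ *: _).
  by case: (F2_cases (bform z' a)) z'a => -> //; rewrite oppr0 oner_eq0.
(* If both were larger, there would be [x] in [S :&: S0] and [y] in [S' :&: S0], neither orthogonal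
   to [a]; then [x + y + a] lies in [S] but has [qform] equal to 1. *)
have n1 : ~ (\dim (H :&: S0) < \dim (S :&: S0) /\ \dim (H :&: S0) < \dim (S' :&: S0))%N.
  case=> l1 l2.
  have ex (T : {vspace vec k}) : (\dim (H :&: S0) < \dim (T :&: S0))%N ->
    (T :&: perp <[a]>)%VS = H -> exists2 x, (x \in T) && (x \in S0) & bform x a = 1.
    move=> l TH; have /subvPn[x] : ~~ (T :&: S0 <= H :&: S0)%VS.
      by apply/negP => /dimvS; rewrite leqNgt l.
    rewrite memv_cap => /andP[xT xS0].
    rewrite memv_cap xS0 andbT -TH memv_cap xT mem_perp /= => xa.
    by exists x; rewrite ?xT // ; case: (F2_cases (bform x a)) xa => // ->; rewrite eqxx.
  have [x /andP[xS xS0] xa] := ex S l1 erefl.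
  have [y /andP[yS' yS0] ya] := ex S' l2 HE.
  have : x + y + a \in S.
    have /memv_imgP[y' y'S yE] := yS'.
    have y'a : bform y' a = 1.
      by rewrite -ya yE reflectionE bformDl bformZl bform_alt mulr0 addr0.
    rewrite yE reflectionE y'a -addrA -(addrA y') -{2}[a]scale1r -scalerDl.
    by rewrite addF2 scale0r addr0 rpredD.
  move/(totally_singularP _ sS); rewrite qformD (totally_singularP _ sS0) ?rpredD //.
  by rewrite bformDl xa ya addF2 addr0 add0r qa => /eqP; rewrite oner_eq0.
clear -leS leS' geS geS' n0 n1.
move: (\dim (S :&: S0)) (\dim (S' :&: S0)) (\dim (H :&: S0)) leS leS' geS geS' n0 n1.
by move=> x y h; lia.
Qed.
End Polarity.

(** * Two-point homogeneity *)

Section Witt.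
Variable k : nat.
Implicit Types (u v : vec k) (S U : {vspace vec k}) (g h : 'End(vec k)).

Lemma bform_nondeg v : (forall u, bform v u = 0) -> v = 0.
Proof.
move=> v0; suff vJ : v *m polar_mx k = 0.
  by rewrite -[v]mulmx1 -polar_mxK mulmxA vJ mul0mx.
apply/rowP => j; have := v0 (row j 1%:M).
by rewrite -{1}(row_id 0 v) bform_rowE trmx1 mulmx1 => ->; rewrite mxE.
Qed.

Lemma bform_qform u v : bform u v = qform (u + v) - qform u - qform v.
Proof. by rewrite qformD -addrA -opprD [_ + bform _ _]addrC addrK. Qed.

(** Injectivity is automatic: [g] preserves [bform], so its kernel is orthogonal to everything. *)
Lemma qform_Oplus g : (forall v, qform (g v) = qform v) -> in_Oplus g.
Proof.
move=> qg; split=> //; apply/eqP; rewrite -subv0; apply/subvP => v.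
rewrite memv_ker memv0 => /eqP gv; apply/eqP/bform_nondeg => u.
have bg : bform (g v) (g u) = bform v u by rewrite !bform_qform -linearD !qg.
by rewrite -bg gv /bform !mul0mx mxE.
Qed.

Lemma Oplus_comp g h : in_Oplus g -> in_Oplus h -> in_Oplus (g \o h)%VF.
Proof.
move=> [_ qg] [_ qh]; by apply: qform_Oplus => v; rewrite comp_lfunE qg qh.
Qed.

Lemma Oplus_inv g : in_Oplus g -> in_Oplus (g^-1)%VF.
Proof.
move=> [/eqP kg qg]; apply: qform_Oplus => v.
by rewrite -qg lker0_lfunVK.
Qed.

Lemma Oplus_limgK g S : in_Oplus g -> (g^-1 @: (g @: S))%VS = S.
Proof. by move=> [/eqP kg _]; rewrite -limg_comp lker0_compVf // lim1g. Qed.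

Lemma Oplus_limgVK g S : in_Oplus g -> (g @: (g^-1 @: S))%VS = S.
Proof. by move=> [/eqP kg _]; rewrite -limg_comp lker0_compfV // lim1g. Qed.

Lemma Oplus_dim g S : in_Oplus g -> \dim (g @: S) = \dim S.
Proof. by move=> [kg _]; rewrite limg_dim_eq // kg capv0. Qed.

Lemma Oplus_dim_cap g S S' : in_Oplus g ->
  \dim (g @: S :&: g @: S') = \dim (S :&: S').
Proof. by move=> Og; have [/eqP kg _] := Og; rewrite -lker0_img_cap // Oplus_dim. Qed.

Lemma singular_full S U : S \in tsing k k -> totally_singular U ->
  (S <= U)%VS -> S = U.
Proof.
rewrite inE => /andP[/eqP dS _] sU SU; apply/eqP; rewrite eqEdim SU dS.
by rewrite isotropic_dim //; apply: singular_isotropic.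
Qed.

(** * Normal forms of maximal totally singular subspaces *)

Definition std_singular : {vspace vec k} := lker (linfun rsubmx).

Lemma mem_std v : (v \in std_singular) = (rsubmx v == 0).
Proof. by rewrite memv_ker lfunE. Qed.

Lemma std_tsing : std_singular \in tsing k k.
Proof.
have sE : totally_singular std_singular.
  apply/totally_singularP => v; rewrite mem_std => /eqP v0.
  by rewrite /qform v0 trmx0 mulmx0 mxE.
rewrite inE sE andbT eqn_leq (isotropic_dim (singular_isotropic sE)) /=.
have := limg_ker_dim (linfun (@rsubmx 'F_2 1 k k)) fullv.
rewrite capfv dimvf dim_matrix mul1r => e.
have := dimvS (subvf (limg (linfun (@rsubmx 'F_2 1 k k)))).
rewrite dimvf dim_matrix mul1r => le.
by rewrite -(leq_add2r k) -{1}e leq_add2l.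
Qed.

Lemma isotropic_mx m (P : 'M['F_2]_(m, k + k)) :
  (forall y : 'rV_m, qform (y *m P) = 0) -> P *m polar_mx k *m P^T = 0.
Proof.
move=> qP; apply/matrixP => i j; rewrite -bform_rowE bform_qform.
by rewrite !rowE -mulmxDl !qP !subr0 mxE.
Qed.

(** A basis [P] of [S] is completed by a dual family [Q] spanning a totally singular subspace; the
    map sending the standard hyperbolic basis to [P], [Q] is orthogonal. *)
Lemma Oplus_from_std S : S \in tsing k k ->
  exists2 g, in_Oplus g & (g @: std_singular)%VS = S.
Proof.
move=> SX; have := SX; rewrite inE => /andP[/eqP/vspace_basis_mx[P fP SP] sS].
have qP (y : 'rV_k) : qform (y *m P) = 0.
  by apply: (totally_singularP _ sS); rewrite SP submxMl.
have [Q0 PQ0] : exists Q0 : 'M_(k, k + k), P *m polar_mx k *m Q0^T = 1%:M.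
  exists ((pinvmx P)^T *m polar_mx k).
  rewrite trmx_mul trmxK polar_mx_tr mulmxA -(mulmxA P) polar_mxK mulmx1.
  by rewrite mulmxVp.
(* Adding [N *m P] preserves duality with [P] and changes [qform (y *m Q0)] by [y *m N *m y^T],
   which is its opposite. *)
pose N := - (lsubmx Q0 *m (rsubmx Q0)^T); pose Q := Q0 + N *m P.
have PQ : P *m polar_mx k *m Q^T = 1%:M.
  rewrite [Q^T]linearD /= [(N *m P)^T]trmx_mul mulmxDr PQ0 mulmxA.
  by rewrite isotropic_mx // mul0mx addr0.
have qQ (y : 'rV_k) : qform (y *m Q) = 0.
  rewrite mulmxDr (mulmxA y N P) qformD qP addr0 bformC.
  rewrite /bform (trmx_mul y Q0) mulmxA -(mulmxA (y *m N) P).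
  rewrite -(mulmxA (y *m N)) PQ0 mulmx1.
  rewrite /qform -mulmx_lsub -mulmx_rsub trmx_mul mulmxN mulNmx !mulmxA.
  by rewrite [X in _ + X]mxE subrr.
pose G := col_mx P Q; pose g : 'End(vec k) := linfun (mulmxr G).
have gE v : g v = lsubmx v *m P + rsubmx v *m Q.
  by rewrite lfunE /= -{1}[v]hsubmxK mul_row_col.
have Og : in_Oplus g.
  apply: qform_Oplus => v; rewrite gE qformD qP qQ !add0r.
  by rewrite /bform trmx_mul mulmxA -(mulmxA (lsubmx v)) -(mulmxA (lsubmx v)) PQ mulmx1.
exists g => //; apply: singular_full => //; first exact: Oplus_tsing Og std_tsing.
apply/subvP => _ /memv_imgP[v vE ->]; rewrite gE; move: vE; rewrite mem_std => /eqP ->.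
by rewrite mul0mx addr0 SP submxMl.
Qed.

(** Pairs [(a, b)] with [b] supported on the first [r] coordinates and [a] vanishing there; for
    [r <= k] this meets [std_singular] in dimension [k - r]. *)
Definition canonical_singular r : {vspace vec k} :=
  (lker (linfun (mulmxr (cokermx (pid_mx r : 'M_k)) \o rsubmx)) :&:
   lker (linfun (mulmxr (pid_mx r : 'M_k)^T \o lsubmx)))%VS.

Lemma mem_canonical r v : (v \in canonical_singular r) =
  (rsubmx v <= (pid_mx r : 'M_k))%MS && (lsubmx v *m (pid_mx r : 'M_k)^T == 0).
Proof.
rewrite memv_cap submxE; congr (_ && _); rewrite memv_ker; congr (_ == _); exact: lfunE.
Qed.

Lemma canonical_totally_singular r : totally_singular (canonical_singular r).
Proof.
apply/totally_singularP => v; rewrite mem_canonical => /andP[/submxP[D vD] /eqP v0].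
by rewrite /qform vD trmx_mul mulmxA v0 mul0mx mxE.
Qed.

(* [N] extends to all of [F_2^k] the alternating form whose graph over the
   projection [T2] of [S] is [S] modulo [S :&: std_singular]; [p *m T2] projects onto
   the row space of [T2]. *)
Lemma Oplus_to_canonical S : S \in tsing k k ->
  exists2 g, in_Oplus g & (g @: std_singular)%VS = std_singular /\
    (g @: S)%VS = canonical_singular (k - \dim (S :&: std_singular)).
Proof.
move=> SX; have := SX; rewrite inE => /andP[/eqP dS sS].
have [T fT ST] := vspace_basis_mx dS.
have qT (y : 'rV_k) : qform (y *m T) = 0.
  by apply: (totally_singularP _ sS); rewrite ST submxMl.
pose T1 := lsubmx T; pose T2 := rsubmx T.
have TE (y : 'rV_k) : y *m T = row_mx (y *m T1) (y *m T2).
  by rewrite -mul_mx_row hsubmxK.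
have qT12 (y : 'rV_k) : y *m T1 *m T2^T *m y^T = 0.
  have := qT y; rewrite /qform TE row_mxKl row_mxKr trmx_mul mulmxA => q0.
  by rewrite [LHS]mx11_scalar q0 raddf0.
have T12 : T1 *m T2^T = - (T2 *m T1^T).
  apply/eqP; rewrite -addr_eq0 -(isotropic_mx qT) -[in X in _ == X](hsubmxK T).
  rewrite mul_row_block !mulmx0 !mulmx1 add0r addr0 tr_row_mx mul_row_col.
  by rewrite addrC.
have [p T2p] : exists p, T2 *m p *m T2 = T2 by exists (pinvmx T2); rewrite mulmxKpV.
move: T1 T2 T2p TE qT12 T12 => T1 T2 T2p TE qT12 T12.
pose N := (p *m T2) *m (p *m T1) *m (p *m T2)^T.
have altN (b : 'rV_k) : b *m N *m b^T = 0.
  have := qT12 (b *m p *m T2 *m p); set y := b *m p *m T2 *m p => q0.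
  have yT2 : y *m T2 = b *m p *m T2 by rewrite /y -2!(mulmxA (b *m p)) T2p.
  have -> : b *m N *m b^T = y *m T1 *m (b *m p *m T2)^T.
    by rewrite /N /y !trmx_mul !mulmxA.
  by rewrite -yT2 trmx_mul mulmxA.
have NT2 : T2 *m N *m T2^T = T1 *m T2^T.
  have -> : T2 *m N *m T2^T = T2 *m p *m T2 *m p *m T1 *m (T2 *m p *m T2)^T.
    by rewrite /N !trmx_mul !mulmxA.
  by rewrite T2p -mulmxA T12 mulmxN mulmxA T2p -T12.
move: N altN NT2 => N altN NT2.
pose r := \rank T2; pose X := row_ebase T2.
have uX : X \in unitmx by apply: row_ebase_unit.
(* The map [(a, b) |-> ((a - b N) X^T, b X^-1)]: the factors [X^T] and [X^-1] cancel in [qform], and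
   [b N b^T = 0]. *)
pose G := block_mx X^T 0 (- N *m X^T) (invmx X).
pose g : 'End(vec k) := linfun (mulmxr G).
have gE v : g v = row_mx ((lsubmx v - rsubmx v *m N) *m X^T) (rsubmx v *m invmx X).
  rewrite lfunE /= -{1}[v]hsubmxK mul_row_block mulmx0 add0r mulmxBl.
  by rewrite mulNmx mulmxN mulmxA.
have Og : in_Oplus g.
  apply: qform_Oplus => v; rewrite /qform gE row_mxKl row_mxKr.
  rewrite trmx_mul trmx_inv mulmxA mulmxK ?unitmx_tr // mulmxBl.
  by rewrite altN subr0.
have gEE : (g @: std_singular)%VS = std_singular.
  apply: singular_full; first exact: Oplus_tsing std_tsing.
    by have := std_tsing; rewrite inE => /andP[].
  apply/subvP => _ /memv_imgP[v vE ->]; rewrite mem_std gE row_mxKr.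
  by move: vE; rewrite mem_std => /eqP ->; rewrite mul0mx.
have rE : (k - \dim (S :&: std_singular))%N = r.
  have := limg_ker_dim (linfun (@rsubmx 'F_2 1 k k)) S; rewrite dS addnC.
  move/(canRL (addnK _)) => <-; apply: dim_mxrank => v.
  apply/memv_imgP/submxP => [[u uS ->] | [D ->]].
    move: uS; rewrite ST => /submxP[D ->]; exists D.
    by rewrite lfunE /= TE row_mxKr.
  exists (D *m T); first by rewrite ST submxMl.
  by rewrite lfunE /= TE row_mxKr.
exists g => //; split=> //; rewrite rE.
apply: singular_full; [exact: Oplus_tsing | exact: canonical_totally_singular |].
apply/subvP => _ /memv_imgP[v + ->]; rewrite ST => /submxP[y ->].
rewrite mem_canonical gE row_mxKl row_mxKr TE row_mxKl row_mxKr.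
have T2E : T2 = col_ebase T2 *m pid_mx r *m X by rewrite mulmx_ebase.
apply/andP; split; first by rewrite {1}T2E !mulmxA mulmxK // submxMl.
rewrite -mulmxA -trmx_mul.
have -> : pid_mx r *m X = invmx (col_ebase T2) *m T2.
  by apply: (canRL (mulKmx (col_ebase_unit T2))); rewrite mulmxA mulmx_ebase.
rewrite trmx_mul mulmxA mulmxBl -(mulmxA y T2) -(mulmxA y T1) -(mulmxA y _ T2^T).
by rewrite NT2 subrr mul0mx.
Qed.

(** Once [S0] is moved to [std_singular], both [S] and [S'] can be carried to the same canonical
    subspace by maps stabilizing [std_singular]. *)
Lemma Oplus_two_point S0 S S' : S0 \in tsing k k -> S \in tsing k k -> S' \in tsing k k ->
  \dim (S :&: S0) = \dim (S' :&: S0) ->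
  exists2 g, in_Oplus g & (g @: S0)%VS = S0 /\ (g @: S)%VS = S'.
Proof.
move=> S0X SX S'X eqd; have [g0 Og0 g0E] := Oplus_from_std S0X.
have Og0V := Oplus_inv Og0.
have dimV U : \dim (g0^-1 @: U :&: std_singular) = \dim (U :&: S0).
  by rewrite -(Oplus_dim_cap (g0^-1 @: U) _ Og0) Oplus_limgVK // g0E.
have [h Oh [hE hS]] := Oplus_to_canonical (Oplus_tsing Og0V SX).
have [h' Oh' [h'E h'S]] := Oplus_to_canonical (Oplus_tsing Og0V S'X).
have Oh'V := Oplus_inv Oh'.
have g0VE : (g0^-1 @: S0)%VS = std_singular by rewrite -g0E Oplus_limgK.
exists (g0 \o (h'^-1 \o (h \o g0^-1)))%VF.
  exact: Oplus_comp Og0 (Oplus_comp Oh'V (Oplus_comp Oh Og0V)).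
rewrite !limg_comp g0VE hE; split.
  by rewrite -{1}h'E Oplus_limgK.
by rewrite hS dimV eqd -dimV -h'S Oplus_limgK // Oplus_limgVK.
Qed.

Lemma Oplus_transitive S S' : S \in tsing k k -> S' \in tsing k k ->
  exists2 g, in_Oplus g & (g @: S)%VS = S'.
Proof.
move=> /Oplus_from_std[g Og <-] /Oplus_from_std[g' Og' <-].
exists (g' \o g^-1)%VF; first by apply: Oplus_comp => //; apply: Oplus_inv.
by rewrite limg_comp Oplus_limgK.
Qed.
End Witt.

(** * The operators with kernel a power of the intersection size *)

Section Action.
Variable k : nat.
Implicit Types (S : Xmax k) (g h : 'End(vec k)).

Lemma act_comp g h S : in_Oplus g -> in_Oplus h -> act (g \o h)%VF S = act g (act h S).
Proof.
by move=> Og Oh; apply: val_inj; rewrite !val_act ?limg_comp //; apply: Oplus_comp.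
Qed.

Lemma actK g : in_Oplus g -> cancel (act g) (act g^-1%VF).
Proof.
move=> Og S; have OgV := Oplus_inv Og.
by apply: val_inj; rewrite !val_act // Oplus_limgK.
Qed.

Lemma act_inj g : in_Oplus g -> injective (act g).
Proof. by move=> /actK/can_inj. Qed.

Lemma dim_cap_act g S S' : in_Oplus g ->
  \dim (val (act g S) :&: val (act g S')) = \dim (val S :&: val S').
Proof. by move=> Og; rewrite !val_act // Oplus_dim_cap. Qed.

Lemma act_transitive S S' : exists2 g, in_Oplus g & act g S = S'.
Proof.
have [g Og gS] := Oplus_transitive (valP S) (valP S').
by exists g => //; apply: val_inj; rewrite val_act.
Qed.

Lemma act_two_point S0 S S' :
  \dim (val S :&: val S0) = \dim (val S' :&: val S0) ->
  exists2 g, in_Oplus g & act g S0 = S0 /\ act g S = S'.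
Proof.
move=> eqd; have [g Og [g0 gS]] := Oplus_two_point (valP S0) (valP S) (valP S') eqd.
by exists g => //; split; apply: val_inj; rewrite val_act.
Qed.

Lemma Xmax_dim S : \dim (val S) = k.
Proof. by have := valP S; rewrite inE => /andP[/eqP]. Qed.

Lemma Xmax_sub S S' : (val S <= val S')%VS -> S = S'.
Proof. by move=> SS'; apply/val_inj/eqP; rewrite eqEdim SS' !Xmax_dim leqnn. Qed.

End Action.

Section IntersectionOperators.
Variables (R : realType) (k : nat).
Local Notation X := (Xmax k).
Local Notation fX := (Xfun R k).
Implicit Types (S : X) (f : fX) (t : nat) (p q : {poly R[i]}).

Definition ipow t S S' : R[i] := (2 ^ \dim (val S :&: val S'))%:R ^+ t.

Lemma ipowC t S S' : ipow t S S' = ipow t S' S.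
Proof. by rewrite /ipow capvC. Qed.

Definition kop_fun t f : fX := [ffun S => \sum_S' f S' * ipow t S S'].

Fact kop_is_linear t : linear (kop_fun t).
Proof.
move=> a f f'; apply/ffunP => S; rewrite !ffunE /= scaler_sumr -big_split /=.
by apply: eq_bigr => S' _; rewrite !ffunE mulrDl -mulrA.
Qed.
HB.instance Definition _ t :=
  GRing.isLinear.Build R[i] fX fX *:%R (kop_fun t) (@kop_is_linear t).

Definition kop t : 'End(fX) := linfun (kop_fun t).

Lemma kopE t f S : kop t f S = \sum_S' f S' * ipow t S S'.
Proof. by rewrite lfunE /= ffunE. Qed.

Lemma mem_lker_kop t f : reflect (kop t f = 0) (f \in lker (kop t)).
Proof. by rewrite memv_ker; apply: eqP. Qed.
Local Opaque kop.

(** Bilinear, not Hermitian; positivity is recovered by pairing [f] with [conjf f]. *)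
Definition dot f f' : R[i] := \sum_S f S * f' S.

Definition conjf f : fX := [ffun S => Num.conj (f S : R[i])].

Lemma dotC f f' : dot f f' = dot f' f.
Proof. by apply: eq_bigr => S _; rewrite mulrC. Qed.

Lemma dot_kop t f f' : dot (kop t f) f' = dot f (kop t f').
Proof.
rewrite /dot; under eq_bigr => S _ do rewrite kopE mulr_suml.
rewrite exchange_big /=; apply: eq_bigr => S _.
rewrite kopE mulr_sumr; apply: eq_bigr => S' _.
by rewrite ipowC -mulrA [ipow _ _ _ * _]mulrC.
Qed.

Lemma dot0l f : dot 0 f = 0.
Proof. by apply: big1 => S _; rewrite ffunE mul0r. Qed.

Lemma dotDl f1 f2 f : dot (f1 + f2) f = dot f1 f + dot f2 f.
Proof. by rewrite -big_split; apply: eq_bigr => S _; rewrite ffunE mulrDl. Qed.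

Lemma kop_conjf t f : kop t (conjf f) = conjf (kop t f).
Proof.
apply/ffunP => S; rewrite kopE !ffunE kopE rmorph_sum /=; apply: eq_bigr => S' _.
by rewrite ffunE rmorphM /= rmorphXn /= conjC_nat.
Qed.

Lemma dot_conjf_eq0 f : dot f (conjf f) = 0 -> f = 0.
Proof.
move=> f0; apply/ffunP => S; rewrite [RHS]ffunE; apply/eqP.
have /psumr_eq0P : forall S, predT S -> 0 <= (f S * conjf f S : R[i]).
  by move=> S' _; rewrite ffunE mul_conjC_ge0.
by move=> /(_ f0 S isT)/eqP; rewrite ffunE mul_conjC_eq0.
Qed.

(** Since [kop t] is real and symmetric, [kop t (kop t f) = 0] makes the norm of [kop t f]
    vanish. *)
Lemma limg_cap_lker t : (limg (kop t) :&: lker (kop t) = 0)%VS.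
Proof.
apply/eqP; rewrite -subv0; apply/subvP => _ /memv_capP[/memv_imgP[f _ ->]].
rewrite memv_ker memv0 => /eqP kkf; apply/eqP/dot_conjf_eq0.
by rewrite -kop_conjf -dot_kop kkf dot0l.
Qed.

Lemma limg_add_lker t : (limg (kop t) + lker (kop t) = fullv)%VS.
Proof.
apply/eqP; rewrite eqEdim subvf dimv_disjoint_sum ?limg_cap_lker //.
by rewrite addnC -(limg_ker_dim (kop t) fullv) capfv leqnn.
Qed.

(** The image is the orthogonal complement of the kernel, so inclusions are reversed. *)
Lemma limg_kop_sub s t : (lker (kop t) <= lker (kop s))%VS ->
  (limg (kop s) <= limg (kop t))%VS.
Proof.
move=> kts; apply/subvP => h hs.
have : h \in (limg (kop t) + lker (kop t))%VS by rewrite limg_add_lker memvf.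
case/memv_addP=> a at_ [b bt hE].
suff b0 : b = 0 by rewrite hE b0 addr0.
(* The component [b] lies in both kernels, so it is orthogonal to [h] and to [a], hence to
   itself. *)
apply: dot_conjf_eq0.
have dot_ker u c f : c \in lker (kop u) -> f \in limg (kop u) -> dot (conjf c) f = 0.
  rewrite memv_ker => /eqP c0 /memv_imgP[f' _ ->].
  rewrite -dot_kop kop_conjf c0; apply: big1 => S _; rewrite !ffunE.
  by rewrite conjC0 mul0r.
have := dot_ker s b h (subvP kts _ bt) hs.
by rewrite hE dotC dotDl dotC (dot_ker t) // add0r.
Qed.

Lemma lker_kop_sub s t : (limg (kop s) <= limg (kop t))%VS ->
  (lker (kop t) <= lker (kop s))%VS.
Proof.
move=> its; apply/subvP => f /mem_lker_kop f0; apply/mem_lker_kop.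
apply/dot_conjf_eq0; rewrite -kop_conjf dot_kop.
have /memv_imgP[f' _ ->] := subvP its _ (memv_img (kop s) (memvf (kop s (conjf f)))).
by rewrite -dot_kop f0 dot0l.
Qed.

(* [|S :&: S'|^t] counts the [t]-tuples of vectors of [S :&: S']. *)
Definition tuple_in t (tau : {ffun 'I_t -> vec k}) S := [forall i, tau i \in val S].
Definition tuple_sum t f (tau : {ffun 'I_t -> vec k}) : R[i] :=
  \sum_(S | tuple_in tau S) f S.

Lemma card_cap (U : {vspace vec k}) : #|[set v | v \in U]| = (2 ^ \dim U)%N.
Proof. by rewrite cardsE card_vspace card_Fp. Qed.

Lemma ipow_tuple t S S' :
  ipow t S S' = \sum_(tau | tuple_in (t := t) tau S) (tuple_in tau S')%:R.
Proof.
rewrite /ipow -natrX -card_cap -[t in LHS]card_ord -card_ffun_on -sum1_card.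
under [RHS]eq_bigr => tau _ do rewrite mulrb.
rewrite -big_mkcondr /= natr_sum; apply: eq_bigl => tau.
apply/ffun_onP/andP => [h | [/forallP h /forallP h'] i]; last first.
  by rewrite inE memv_cap h h'.
by split; apply/forallP => i; have := h i; rewrite inE memv_cap => /andP[].
Qed.

Lemma kop_tuple t f S : kop t f S = \sum_(tau | tuple_in (t := t) tau S) tuple_sum f tau.
Proof.
rewrite kopE; under eq_bigr => S' _ do rewrite ipow_tuple mulr_sumr.
rewrite exchange_big /=; apply: eq_bigr => tau _.
rewrite /tuple_sum [RHS]big_mkcond; apply: eq_bigr => S' _.
by case: tuple_in; rewrite ?mulr1 ?mulr0.
Qed.

Lemma dot_kop_conjf t f :
  dot (kop t f) (conjf f) = \sum_(tau : {ffun 'I_t -> vec k}) `|tuple_sum f tau| ^+ 2.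
Proof.
rewrite /dot; under eq_bigr => S _ do rewrite kop_tuple mulr_suml big_mkcond.
rewrite exchange_big /=; apply: eq_bigr => tau _.
rewrite normCK rmorph_sum mulr_sumr [RHS]big_mkcond; apply: eq_bigr => S _.
by rewrite ffunE.
Qed.

Lemma dot_kop_conjf_ge0 t f : 0 <= dot (kop t f) (conjf f).
Proof. by rewrite dot_kop_conjf sumr_ge0 // => tau _; rewrite exprn_ge0. Qed.

Lemma lker_kop_tuple t f :
  (f \in lker (kop t)) <-> forall tau : {ffun 'I_t -> vec k}, tuple_sum f tau = 0.
Proof.
rewrite memv_ker; split=> [/eqP f0 tau | f0].
  have := dot_kop_conjf t f; rewrite f0 dot0l => /esym/psumr_eq0P.
  move=> /(_ (fun _ _ => exprn_ge0 _ (normr_ge0 _)) tau isT)/eqP.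
  by rewrite expf_eq0 normr_eq0 => /eqP.
by apply/eqP/ffunP => S; rewrite kop_tuple [RHS]ffunE big1.
Qed.

Lemma dot_kop_conjf_eq0 t f : dot (kop t f) (conjf f) = 0 -> f \in lker (kop t).
Proof.
rewrite dot_kop_conjf => /psumr_eq0P f0; apply/lker_kop_tuple => tau.
have /eqP := f0 (fun _ _ => exprn_ge0 _ (normr_ge0 _)) tau isT.
by rewrite expf_eq0 normr_eq0 => /eqP.
Qed.

(** The subspaces of dimension at most [t] are exactly the spans of [t]-tuples, and [tuple_sum]
    depends only on the span. *)
Lemma lker_kopP t f : (f \in lker (kop t)) <->
  forall U : {vspace vec k}, (\dim U <= t)%N -> \sum_(S | (U <= val S)%VS) f S = 0.
Proof.
rewrite lker_kop_tuple; split=> [f0 U dU | f0 tau].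
  (* A basis of [U] is padded to length [t] by the default value 0 of [nth], which lies in every
     subspace. *)
  rewrite -[RHS](f0 [ffun i : 'I_t => (vbasis U)`_i]); apply: eq_bigl => S.
  have -> : (U <= val S)%VS = (<<vbasis U>> <= val S)%VS.
    by rewrite (span_basis (vbasisP U)).
  apply/span_subvP/forallP => [US i | US v].
    rewrite ffunE; case: (ltnP i (size (vbasis U))) => [lti | gei].
      exact: (US _ (mem_nth 0 lti)).
    by rewrite nth_default // mem0v.
  case/tnthP=> i ->; rewrite (tnth_nth 0).
  by have := US (Ordinal (leq_trans (ltn_ord i) dU)); rewrite ffunE.
rewrite -[RHS](f0 <<codom tau>>%VS); last first.
  by apply: leq_trans (dim_span _) _; rewrite size_codom card_ord.
apply: eq_bigl => S; apply/forallP/span_subvP => [tS v /codomP[i ->] // | tS i].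
exact/tS/codom_f.
Qed.

Lemma lker_kopS s t : (s <= t)%N -> (lker (kop t) <= lker (kop s))%VS.
Proof.
move=> st; apply/subvP => f /lker_kopP f0; apply/lker_kopP => U dU.
exact/f0/(leq_trans dU).
Qed.

Lemma limg_kopS s t : (s <= t)%N -> (limg (kop s) <= limg (kop t))%VS.
Proof. by move=> st; apply/limg_kop_sub/lker_kopS. Qed.

Lemma lker_kop_top t : (k <= t)%N -> lker (kop t) = 0%VS.
Proof.
move=> kt; apply/eqP; rewrite -subv0; apply/subvP => f /lker_kopP f0.
rewrite memv0; apply/eqP/ffunP => S; rewrite [RHS]ffunE.
rewrite -[RHS](f0 (val S)) ?Xmax_dim // (big_pred1 S) // => S'.
by apply/idP/eqP => [/Xmax_sub // | ->]; rewrite subvv.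
Qed.

Lemma limg_kop_top t : (k <= t)%N -> limg (kop t) = fullv.
Proof. by move=> /lker_kop_top k0; have := limg_add_lker t; rewrite k0 addv0. Qed.

Lemma actf_kop t g f : in_Oplus g -> kop t (actf g f) = actf g (kop t f).
Proof.
move=> Og; apply/ffunP => S; rewrite kopE ffunE kopE.
rewrite [RHS](reindex_inj (act_inj Og)) /=; apply: eq_bigr => S' _.
by rewrite ffunE /ipow dim_cap_act.
Qed.

Lemma invariant_limg_kop t : invariant_sub (limg (kop t)).
Proof.
by move=> g f Og /memv_imgP[f' _ ->]; rewrite -actf_kop // memv_img ?memvf.
Qed.

Lemma invariant_lker_kop t : invariant_sub (lker (kop t)).
Proof.
move=> g f Og; move/mem_lker_kop => f0; apply/mem_lker_kop; rewrite actf_kop // f0.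
by apply/ffunP => S; rewrite !ffunE.
Qed.

Lemma invariant_cap (U W : {vspace fX}) :
  invariant_sub U -> invariant_sub W -> invariant_sub (U :&: W).
Proof.
by move=> iU iW g f Og; rewrite !memv_cap => /andP[fU fW]; rewrite iU ?iW.
Qed.

(** * Zonal functions given by polynomials in the intersection size *)

Definition zpoly (p : {poly R[i]}) S0 : fX :=
  [ffun S => p.[(2 ^ \dim (val S :&: val S0))%:R]].

Lemma zpolyD p q S0 : zpoly (p + q) S0 = zpoly p S0 + zpoly q S0.
Proof. by apply/ffunP => S; rewrite !ffunE hornerD. Qed.

Lemma zpolyZ c p S0 : zpoly (c *: p) S0 = c *: zpoly p S0.
Proof. by apply/ffunP => S; rewrite !ffunE hornerZ. Qed.

Lemma zpolyXn t S0 : zpoly 'X^t S0 = kop t [ffun S => (S == S0)%:R].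
Proof.
apply/ffunP => S; rewrite kopE ffunE hornerXn (bigD1 S0) //= ffunE eqxx mul1r.
by rewrite big1 ?addr0 // => S' ne; rewrite ffunE (negPf ne) mul0r.
Qed.

Lemma zpoly_sum p S0 : zpoly p S0 = \sum_(i < size p) p`_i *: zpoly 'X^i S0.
Proof.
apply/ffunP => S; rewrite sum_ffunE ffunE horner_coef; apply: eq_bigr => i _.
by rewrite !ffunE hornerXn.
Qed.

Lemma zpoly_actf g p S0 : in_Oplus g -> actf g (zpoly p (act g S0)) = zpoly p S0.
Proof. by move=> Og; apply/ffunP => S; rewrite !ffunE dim_cap_act. Qed.

Lemma zpoly_sym p S S0 : zpoly p S0 S = zpoly p S S0.
Proof. by rewrite !ffunE capvC. Qed.

Lemma zpoly_limg p S0 t : (size p <= t.+1)%N -> zpoly p S0 \in limg (kop t).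
Proof.
move=> sp; rewrite zpoly_sum memv_suml // => i _; apply: memvZ.
apply: (subvP (limg_kopS (_ : i <= t)%N)); first by rewrite -ltnS (leq_trans _ sp).
by rewrite zpolyXn memv_img ?memvf.
Qed.

Lemma zpoly_invariant (U : {vspace fX}) p S0 : invariant_sub U ->
  zpoly p S0 \in U -> forall S, zpoly p S \in U.
Proof.
move=> iU pU S; have [g Og gS] := act_transitive S S0.
by rewrite -(zpoly_actf p S Og) gS iU.
Qed.

(** By [zpolyXn] these functions are the images of the delta functions, which span. *)
Lemma limg_kop_zpoly t (U : {vspace fX}) :
  (forall S, zpoly 'X^t S \in U) -> (limg (kop t) <= U)%VS.
Proof.
move=> XU; apply/subvP => _ /memv_imgP[f _ ->].
have -> : kop t f = \sum_S f S *: zpoly 'X^t S.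
  apply/ffunP => S; rewrite kopE sum_ffunE; apply: eq_bigr => S' _.
  by rewrite !ffunE hornerXn.
by rewrite memv_suml // => S _; apply: memvZ.
Qed.

End IntersectionOperators.

(** * The q-Krawtchouk decomposition *)

Lemma subspace_of_dim (K : fieldType) (vT : vectType K) (S : {vspace vT}) m :
  (m <= \dim S)%N -> exists2 T : {vspace vT}, (T <= S)%VS & \dim T = m.
Proof.
move=> mS; have fr := basis_free (vbasisP S).
exists <<take m (vbasis S)>>%VS.
  by apply/span_subvP => v /mem_take; apply: vbasis_mem.
move: fr; rewrite -{1}(cat_take_drop m (vbasis S)) => /catl_free.
by rewrite /free => /eqP ->; rewrite size_takel ?size_tuple.
Qed.

Lemma coef_size_neq0 (A : nzSemiRingType) (p : {poly A}) j :
  size p = j.+1 -> p`_j != 0.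
Proof.
by move=> sp; have := lead_coef_eq0 p; rewrite /lead_coef sp -size_poly_eq0 sp => ->.
Qed.

Section Decomposition.
Variables (R : realType) (k : nat).
Local Notation X := (Xmax k).
Local Notation fX := (Xfun R k).
Local Opaque kop.
Local Notation kop := (kop R k).
Implicit Types (S : X) (f h : fX) (t : nat) (p q : {poly R[i]}).

Definition std_Xmax : X := Sub (std_singular k) (std_tsing k).

(** A reflection in a nonsingular vector orthogonal to [W] fixes [W] pointwise, so it permutes the
    [S] above [W], and it reverses every sign. *)
Lemma sum_sign_eq0 S0 (W : {vspace vec k}) : (\dim W < k)%N ->
  \sum_(S : X | (W <= val S)%VS) (-1) ^+ \dim (val S :&: val S0) = 0 :> R[i].
Proof.
move=> /perp_nonsingular[a /perpP aW qa].
have Or := Oplus_reflection qa; have [/eqP kr _] := Or.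
have rW : (reflection a @: W)%VS = W.
  rewrite -[RHS]lim1g; apply: eq_in_limg => w wW.
  by rewrite id_lfunE reflection_perp // bformC aW.
set x := LHS; suff: x = - x by move/eqP; rewrite -addr_eq0 -mulr2n mulrn_eq0 => /eqP.
rewrite {1}/x (reindex_inj (act_inj Or)) /= -sumrN; apply: eq_big => S.
  by rewrite val_act // -{1}rW limg_ker0.
move=> _; rewrite val_act // -signr_odd dim_cap_reflection ?(valP S) ?(valP S0) //.
by rewrite -[in RHS]signr_odd; case: (odd _); rewrite ?expr0 ?expr1 ?opprK.
Qed.

(* The sign of the family of [S], restricted to the [S] above a fixed [T] of
   dimension [k - l.+1], separates the kernels. *)
Lemma lker_kop_strict l : (l < k)%N ->
  exists2 f, f \in lker (kop l) & f \notin lker (kop l.+1).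
Proof.
move=> lk; pose S0 := std_Xmax.
have [T TS0 dT] : exists2 T, (T <= val S0)%VS & \dim T = (k - l.+1)%N.
  by apply: subspace_of_dim; rewrite Xmax_dim leq_subr.
pose sgn S : R[i] := (-1) ^+ \dim (val S :&: val S0).
pose f : fX := [ffun S => if (T <= val S)%VS then sgn S else 0].
exists f.
  apply/lker_kopP => W dW; under eq_bigr => S _ do rewrite ffunE.
  rewrite -big_mkcondr /=.
  rewrite (eq_bigl (fun S : X => (W + T <= val S)%VS)); last first.
    by move=> S; rewrite subv_add.
  (* The dimension of [W + T] is at most [l + (k - l.+1)], which is less than [k]. *)
  apply: sum_sign_eq0; apply: leq_ltn_trans (leq_of_leqif (dimv_add_leqif _ _)) _.
  by move: dW lk; rewrite dT; clear; move: (\dim W) => w; lia.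
(* On a complement of [T] in [S0], of dimension [l.+1], only [S0] contributes: an [S] above it and
   above [T] contains [S0]. *)
apply/negP => /lker_kopP/(_ (val S0 :\: T)%VS).
have -> : (\dim (val S0 :\: T) <= l.+1)%N.
  have := dimv_cap_compl (val S0) T; rewrite (capv_idPr TS0) dT Xmax_dim.
  by move: lk; clear; move: (\dim (_ :\: _)) => w; lia.
move=> /(_ isT)/eqP; rewrite (bigD1 S0) ?diffvSl //= big1 ?addr0.
  by rewrite ffunE TS0 /sgn signr_eq0.
move=> S /andP[US nS]; rewrite ffunE; case: ifP => // TS.
case/eqP: nS; apply/esym/Xmax_sub; apply: subv_trans (_ : _ <= _ + T)%VS _.
  exact: addvSl.
by rewrite -addv_diff subv_add US.
Qed.

Lemma neq0_value f : f \notin 0%VS -> exists S0, f S0 != 0.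
Proof.
move=> f0; apply/existsP; apply: contraR f0; rewrite negb_exists => /forallP f0.
by rewrite memv0; apply/eqP/ffunP => S; rewrite ffunE; apply/eqP/negPn.
Qed.

(** * Functions fixed by the stabilizer of a point *)

Definition radial S0 f := forall S S',
  \dim (val S :&: val S0) = \dim (val S' :&: val S0) -> f S = f S'.

Lemma fixed_radial S0 f :
  (forall g, in_Oplus g -> act g S0 = S0 -> actf g f = f) -> radial S0 f.
Proof.
move=> fixf S S' /act_two_point[g Og [g0 <-]].
by rewrite -{1}(fixf g Og g0) ffunE.
Qed.

(** Lagrange interpolation at the [k.+1] distinct nodes [2 ^ i], [i <= k]. *)
Lemma radial_zpoly S0 f : radial S0 f ->
  exists2 p : {poly R[i]}, (size p <= k.+1)%N & f = zpoly p S0.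
Proof.
move=> rf; pose x i : R[i] := (2 ^ i)%:R.
have xI : injective x.
  by move=> i j /eqP; rewrite eqr_nat eqn_exp2l // => /eqP.
(* The default 0 is harmless: the interpolant is evaluated only at dimensions realized by some
   [S]. *)
pose c (i : nat) : R[i] :=
  if [pick S : X | \dim (val S :&: val S0) == i] is Some S1 then f S1 else 0.
pose L := tnth (k.+1.-lagrange x).
exists (\sum_(i < k.+1) c i *: (L i : {poly R[i]})).
  apply: leq_trans (size_sum _ _ _) _; apply/bigmax_leqP => i _.
  by apply: leq_trans (size_scale_leq _ _) _; rewrite size_lagrange_.
apply/ffunP => S; rewrite ffunE.
have lt : (\dim (val S :&: val S0) < k.+1)%N.
  by rewrite ltnS -[X in (_ <= X)%N](Xmax_dim S) dimvS // capvSl.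
rewrite horner_sum (bigD1 (Ordinal lt)) //= big1 ?addr0 => [|i ne].
  rewrite hornerZ (lagrange_sample _ xI _ (Ordinal lt)) // eqxx mulr1.
  by rewrite /c; case: pickP => [S' /eqP/esym/rf // | /(_ S)]; rewrite eqxx.
by rewrite hornerZ (lagrange_sample _ xI _ (Ordinal lt)) // (negPf ne) mulr0.
Qed.

Lemma radial_average (U : {vspace fX}) S0 f : invariant_sub U -> f \in U -> f S0 != 0 ->
  exists2 h, h \in U & radial S0 h /\ h S0 != 0.
Proof.
move=> iU fU f0.
(* The average runs over the finite set of permutations of [X] induced by the stabilizer of [S0]. *)
pose ind (s : {perm X}) := exists2 g, in_Oplus g & act g S0 = S0 /\ s =1 act g.
pose P := [set s : {perm X} | `[< ind s >]].
have inP s : s \in P -> ind s by rewrite inE => /asboolP.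
have indP s : ind s -> s \in P by move=> si; rewrite inE; apply/asboolP.
exists (\sum_(s in P) [ffun S => f (s S)]).
  apply: memv_suml => s /inP[g Og [g0 sg]].
  rewrite (_ : [ffun S => f (s S)] = actf g f) ?iU //.
  by apply/ffunP => S; rewrite !ffunE sg.
split.
  move=> S S' /act_two_point[g Og [g0 <-]]; rewrite !sum_ffunE.
  pose s0 := perm (act_inj Og).
  rewrite (reindex_inj (mulgI s0)) /=; apply: eq_big => [s | s _]; last first.
    by rewrite !ffunE permM permE.
  apply/idP/idP => /inP[g1 Og1 [g10 sg1]]; apply: indP; last first.
    exists (g1 \o g)%VF; first exact: Oplus_comp.
    by split=> [|S1]; rewrite act_comp // ?g0 // permM permE sg1.
  have OgV := Oplus_inv Og.
  exists (g1 \o g^-1)%VF; first exact: Oplus_comp.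
  split=> [|S1]; rewrite act_comp //; first by rewrite -{1}g0 actK.
  rewrite -sg1 permM permE; congr (s _); apply/esym.
  by apply: (act_inj OgV); rewrite actK.
(* Every term equals [f S0] at the pole, and there is at least one term, the identity. *)
rewrite sum_ffunE (eq_bigr (fun=> f S0)) => [|s /inP[g _ [g0 sg]]]; last first.
  by rewrite ffunE sg g0.
rewrite sumr_const mulrn_eq0 negb_or f0 andbT -lt0n; apply/card_gt0P.
exists 1%g; apply: indP; exists \1%VF; last first.
  by split=> [|S]; apply: val_inj; rewrite ?perm1 val_insubd lim1g if_same.
by apply: qform_Oplus => v; rewrite id_lfunE.
Qed.

(** * The components cut out by the filtration of images *)

Definition lower j : {vspace fX} := if j is i.+1 then limg (kop i) else 0%VS.

(** At [j = 0] the conventions are that the image of the preceding operator is 0 and its kernel is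
    everything. *)
Definition qV j : {vspace fX} :=
  (limg (kop j) :&: if j is i.+1 then lker (kop i) else fullv)%VS.

Lemma zpoly_lower p S0 j : (size p <= j)%N -> zpoly p S0 \in lower j.
Proof.
case: j => [|j] sp; last exact: zpoly_limg.
by rewrite zpoly_sum big1 ?mem0v // => i _; have := leq_trans (ltn_ord i) sp.
Qed.

Lemma qV_cap_lower j : (qV j :&: lower j = 0)%VS.
Proof.
case: j => [|j]; first by rewrite capv0.
apply/eqP; rewrite -subv0 -(limg_cap_lker R k j) capvC capvS //.
exact: capvSr.
Qed.

(** The modular law, applied to [lower j] inside [limg (kop j)] and to the splitting of the whole
    space by image and kernel. *)
Lemma qV_add_lower j : (lower j + qV j = limg (kop j))%VS.
Proof.
case: j => [|j]; first by rewrite add0v /qV capvf.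
by rewrite /qV capvC vspace_modl ?limg_add_lker ?capfv // limg_kopS.
Qed.

Lemma invariant_qV j : invariant_sub (qV j).
Proof.
apply: invariant_cap; first exact: invariant_limg_kop.
by case: j => [|j]; [move=> g f _ _; exact: memvf | exact: invariant_lker_kop].
Qed.

Lemma limg_not_lower j : (j <= k)%N -> ~~ (limg (kop j) <= lower j)%VS.
Proof.
case: j => [_ | j jk].
  apply/negP => /subvP/(_ (zpoly 1 std_Xmax)).
  rewrite zpoly_limg ?size_poly1 // memv0 => /(_ isT)/eqP/ffunP/(_ std_Xmax)/eqP.
  by rewrite !ffunE hornerC oner_eq0.
apply/negP => /lker_kop_sub /subvP sub; have [f f0 /negP[]] := lker_kop_strict jk.
exact: sub.
Qed.

(** If the degree [l] exceeded [j], the leading term would put every [zpoly 'X^l S] into [lower l],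
    against [limg_not_lower]. *)
Lemma zpoly_size p S0 j : (size p <= k.+1)%N -> zpoly p S0 \in limg (kop j) ->
  (size p <= j.+1)%N.
Proof.
move=> pk pj; rewrite leqNgt; apply/negP => ltj.
have [l sp] : exists l, size p = l.+1.
  by exists (size p).-1; rewrite prednK // (leq_trans _ ltj).
have lk : (l <= k)%N by rewrite -ltnS -sp.
have jl : (limg (kop j) <= lower l)%VS.
  by case: l sp {lk} => [|l] sp; [rewrite sp in ltj | apply: limg_kopS; rewrite sp !ltnS in ltj].
have p0 : p`_l != 0 by exact: coef_size_neq0.
case/negP: (limg_not_lower lk); apply: limg_kop_zpoly => S.
apply: (@zpoly_invariant _ _ _ _ S0).
  case: l {sp lk jl p0} => [g f _|l]; last exact: invariant_limg_kop.
  by rewrite !memv0 => /eqP ->; apply/eqP/ffunP => S1; rewrite !ffunE.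
have pE : p = p`_l *: 'X^l + (p - p`_l *: 'X^l) by rewrite addrC subrK.
have /zpoly_lower low : (size (p - p`_l *: 'X^l)%R <= l)%N.
  apply/leq_sizeP => i; rewrite leq_eqVlt => /orP[/eqP <-|li].
    by rewrite coefB coefZ coefXn eqxx mulr1 subrr.
  by rewrite coefB coefZ coefXn gtn_eqF // mulr0 subr0 nth_default // sp.
have := subvP jl _ pj; rewrite {1}pE zpolyD rpredDr ?low // zpolyZ.
by rewrite rpredZeq (negPf p0).
Qed.

(** Averaging a nonzero element of [qV j] gives a polynomial zonal function; its degree is at most
    [j] by [zpoly_size], and not less because [qV j] meets [lower j] trivially. *)
Lemma qV_zonal j : (j <= k)%N ->
  exists2 p : {poly R[i]}, size p = j.+1 &
    forall S0, zpoly p S0 \in qV j /\ zpoly p S0 S0 = 1.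
Proof.
move=> jk; have /subvPn[f fq f0] : ~~ (qV j <= 0)%VS.
  apply: contra (limg_not_lower jk); rewrite subv0 => /eqP q0.
  by rewrite -qV_add_lower q0 addv0.
have [S0 fS0] := neq0_value f0.
have [h hq [/radial_zpoly[p pk hp] hS0]] := radial_average (@invariant_qV j) fq fS0.
have pj : (size p <= j.+1)%N.
  by apply: (@zpoly_size p S0) => //; rewrite -hp; case/memv_capP: hq.
have sp : size p = j.+1.
  apply/eqP; rewrite eqn_leq pj ltnNge; apply/negP => /(zpoly_lower S0) pl.
  have : h \in (qV j :&: lower j)%VS by rewrite memv_cap hq hp.
  by rewrite qV_cap_lower memv0 => /eqP h0; rewrite h0 ffunE eqxx in hS0.
have vS S : zpoly p S S = h S0 by rewrite hp !ffunE !capvv !Xmax_dim.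
exists ((h S0)^-1 *: p); first by rewrite size_scale // invr_eq0.
move=> S; rewrite zpolyZ; split; last by rewrite ffunE vS; exact: mulVf.
by apply: memvZ; apply: (zpoly_invariant (@invariant_qV j) (S0 := S0)); rewrite -hp.
Qed.

(** Cancelling the coefficient of degree [j] leaves an element of both [qV j] and [lower j], that
    is, 0. *)
Lemma qV_radial j p S0 h : size p = j.+1 -> (j <= k)%N ->
  zpoly p S0 \in qV j -> h \in qV j -> radial S0 h -> exists c, h = c *: zpoly p S0.
Proof.
move=> sp jk pq hq /radial_zpoly[q qk hE].
have qj : (size q <= j.+1)%N.
  by apply: (@zpoly_size q S0) => //; rewrite -hE; case/memv_capP: hq.
have p0 : p`_j != 0 by exact: coef_size_neq0.
pose c := q`_j / p`_j; exists c; apply/eqP; rewrite -subr_eq0.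
rewrite -memv0 -(qV_cap_lower j) memv_cap rpredB ?memvZ //= hE -zpolyZ.
rewrite -scaleN1r -zpolyZ -zpolyD; apply: zpoly_lower.
apply/leq_sizeP => i; rewrite leq_eqVlt => /orP[/eqP <-|ji].
  by rewrite coefD !coefZ divfK // mulN1r subrr.
by rewrite coefD !coefZ !nth_default ?sp // ?mulr0 ?addr0 // (leq_trans qj).
Qed.

(** A nonzero invariant [U] in [qV j] contains a radial function nonzero at its pole, hence all
    zonal functions of [qV j]; modulo [lower j] these span [limg (kop j)]. *)
Lemma qV_irreducible j : (j <= k)%N -> irreducible_sub (qV j).
Proof.
move=> jk; have [p sp pq] := qV_zonal jk; split; last 1 first.
- move=> U Uq iU; have [->|U0] := eqVneq U 0%VS; [by left | right].
  move: U0; rewrite -subv0 => /subvPn[f fU f0].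
  have [S0 fS0] := neq0_value f0.
  have [h hU [rh hS0]] := radial_average iU fU fS0.
  have [c hc] := qV_radial sp jk (pq S0).1 (subvP Uq _ hU) rh.
  have c0 : c != 0 by apply: contraNneq hS0 => c0; rewrite hc c0 scale0r ffunE.
  have pU S : zpoly p S \in U.
    by apply: (zpoly_invariant iU (S0 := S0)); move: hU; rewrite hc rpredZeq (negPf c0).
  have p0 : p`_j != 0 by exact: coef_size_neq0.
  have le : (limg (kop j) <= U + lower j)%VS.
    apply: limg_kop_zpoly => S.
    have -> : 'X^j = (p`_j)^-1 *: p + ('X^j - (p`_j)^-1 *: p) by rewrite addrC subrK.
    rewrite zpolyD zpolyZ memv_add ?memvZ //; apply: zpoly_lower.
    apply/leq_sizeP => i; rewrite leq_eqVlt => /orP[/eqP <-|ji].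
      by rewrite coefB coefZ coefXn eqxx mulVf // subrr.
    rewrite coefB coefZ coefXn gtn_eqF //.
    by rewrite (nth_default 0 (_ : size p <= i)%N) ?sp // mulr0 subrr.
  apply/eqP; rewrite eqEsubv Uq -[X in (_ <= X)%VS]addv0 -(qV_cap_lower j).
  rewrite [(qV j :&: _)%VS]capvC vspace_modl // subv_cap subvv andbT.
  by apply: subv_trans le; apply: capvSl.
- move=> q0; have [] := pq std_Xmax; rewrite q0 memv0 => /eqP -> /eqP.
  by rewrite ffunE eq_sym oner_eq0.
- exact: invariant_qV.
Qed.

Lemma qV_cap i j : (i < j)%N -> (qV i :&: qV j = 0)%VS.
Proof.
case: j => // j; rewrite ltnS => ij; apply/eqP; rewrite -subv0 -(qV_cap_lower j.+1).
rewrite capvC capvS // (subv_trans (capvSl _ _)) //; exact: limg_kopS.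
Qed.

(* For an intertwiner [T], [T (zpoly p S0) S1] depends only on [\dim (S0 :&: S1)], so
   it is a function of [S0] lying in both [qV i] and [qV j]. *)
Lemma qV_not_isomorphic i j : (i <= k)%N -> (j <= k)%N -> i != j ->
  ~ isomorphic_sub (qV i) (qV j).
Proof.
move=> ik jk nij [T [TU TK Tg]].
have [p sp pq] := qV_zonal ik; have [q sq qq] := qV_zonal jk.
pose S1 := std_Xmax.
have rad S : radial S (T (zpoly p S)).
  apply: fixed_radial => g Og gS; rewrite -Tg ?(pq S).1 //.
  by congr (T _); rewrite -{1}gS zpoly_actf.
have TS S : T (zpoly p S) \in qV j by rewrite -TU memv_img ?(pq S).1.
have [c cE] := qV_radial sq jk (qq S1).1 (TS S1) (rad S1).
have TE S : T (zpoly p S) = c *: zpoly q S.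
  have [g Og gS] := act_transitive S S1.
  have zS r : zpoly r S = actf g (zpoly r S1) by rewrite -gS zpoly_actf.
  by rewrite zS (Tg _ _ Og (pq S1).1) cE -zpolyZ -zS zpolyZ.
have in_i : c *: zpoly q S1 \in qV i.
  pose del S : fX := [ffun S' => (S' == S)%:R].
  (* The left side is [S0 |-> T (zpoly p S0) S1]; [zpoly p S0] is expanded in delta functions and
     [zpoly_sym] exchanges the two points. *)
  have -> : c *: zpoly q S1 = \sum_S T (del S) S1 *: zpoly p S.
    apply/ffunP => S0; rewrite sum_ffunE.
    transitivity (T (zpoly p S0) S1).
      by rewrite TE !ffunE capvC.
    have -> : zpoly p S0 = \sum_S zpoly p S0 S *: del S.
      apply/ffunP => S; rewrite sum_ffunE (bigD1 S) //= big1 ?addr0.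
        by rewrite [RHS]ffunE [del _ _]ffunE eqxx; exact/esym/mulr1.
      by move=> S' ne; rewrite [LHS]ffunE [del _ _]ffunE eq_sym (negPf ne) scaler0.
    rewrite linear_sum sum_ffunE; apply: eq_bigr => S _.
    by rewrite linearZ [LHS]ffunE [RHS]ffunE zpoly_sym; exact: mulrC.
  by rewrite memv_suml // => S _; rewrite memvZ ?(pq S).1.
have in_j : c *: zpoly q S1 \in qV j by rewrite memvZ ?(qq S1).1.
have : c *: zpoly q S1 \in (qV i :&: qV j)%VS by rewrite memv_cap in_i.
have -> : (qV i :&: qV j = 0)%VS.
  by case: (ltngtP i j) nij => // ij _; [rewrite qV_cap | rewrite capvC qV_cap].
rewrite memv0 -TE => T0; have : zpoly p S1 \in (qV i :&: lker T)%VS.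
  by rewrite memv_cap (pq S1).1 memv_ker.
rewrite TK memv0 => /eqP p0; have := (pq S1).2; rewrite p0 ffunE => /eqP.
by rewrite eq_sym oner_eq0.
Qed.

Lemma sum_qV m : (\sum_(j < m.+1) qV j = limg (kop m))%VS.
Proof.
elim: m => [|m IH]; rewrite big_ord_recr /=.
  by rewrite big_ord0 -qV_add_lower.
by rewrite IH -(qV_add_lower m.+1).
Qed.

(** Gives directness of the sum by counting dimensions. *)
Lemma dim_sum_qV m : (\sum_(j < m.+1) \dim (qV j))%N = \dim (limg (kop m)).
Proof.
elim: m => [|m IH]; rewrite big_ord_recr /=.
  by rewrite big_ord0 -qV_add_lower add0v.
by rewrite IH -(qV_add_lower m.+1) dimv_disjoint_sum // capvC qV_cap_lower.
Qed.

Lemma qV0 : qV 0 = <[ [ffun=> 1] : fX ]>%VS.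
Proof.
apply/eqP; rewrite /qV capvf eqEsubv; apply/andP; split.
  apply: limg_kop_zpoly => S; rewrite (_ : zpoly _ _ = [ffun=> 1]) ?memv_line //.
  by apply/ffunP => S'; rewrite !ffunE hornerC.
rewrite -memvE (_ : [ffun=> 1] = zpoly 1 std_Xmax) ?zpoly_limg ?size_poly1 //.
by apply/ffunP => S'; rewrite !ffunE hornerC.
Qed.

(** Makes the quantifier over decompositions in [is_design] nonvacuous. *)
Lemma qV_decomposition : qKrawtchouk_decomposition (fun j : 'I_k.+1 => qV j).
Proof.
have jk (j : 'I_k.+1) : (j <= k)%N by rewrite -ltnS.
split; [split | | | exact: qV0 |].
- by rewrite sum_qV limg_kop_top.
- by rewrite directvE /= sum_qV dim_sum_qV.
- by move=> j; apply: qV_irreducible.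
- by move=> i j nij; apply: qV_not_isomorphic.
move=> j; have [p sp pq] := qV_zonal (jk j); exists p => // S0.
have [p1 p2] := pq S0; split=> // g Og gS.
by rewrite -{1}gS; apply: zpoly_actf.
Qed.

End Decomposition.

(** * Energy and designs *)

Section Energy.
Variables (R : realType) (k t : nat).
Local Notation X := (Xmax k).
Local Notation fX := (Xfun R k).
Local Opaque kop.
Local Notation kop := (kop R k).
Implicit Types (S : X) (f h : fX) (Sigma : {set {vspace vec k}}).

Definition chi Sigma : fX := [ffun S => (val S \in Sigma)%:R].
Definition cstf1 : fX := [ffun=> 1].
(** The projection of the indicator function to the orthogonal complement of the constants, when
    [Sigma] consists of points of [X_k]. *)
Definition centred Sigma : fX := chi Sigma - (#|Sigma|%:R / #|X|%:R : R[i]) *: cstf1.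

Lemma sum_Xmax (T : nmodType) Sigma (F : {vspace vec k} -> T) :
  Sigma \subset tsing k k ->
  \sum_(S in Sigma) F S = \sum_(S : X | val S \in Sigma) F (val S).
Proof.
move=> /subsetP sub; rewrite -(big_sub_cond _ (mem Sigma)) /=; apply: eq_bigl => S.
by apply/idP/andP => [SS|[]//]; rewrite sub.
Qed.

Lemma dot_chi Sigma h : dot (chi Sigma) h = \sum_(S : X | val S \in Sigma) h S.
Proof.
rewrite /dot [RHS]big_mkcond; apply: eq_bigr => S _; rewrite ffunE.
by case: (_ \in _); rewrite ?mul1r ?mul0r.
Qed.

Lemma dot_one h : dot cstf1 h = \sum_S h S.
Proof. by apply: eq_bigr => S _; rewrite ffunE mul1r. Qed.

Lemma sum_chi Sigma : Sigma \subset tsing k k -> \sum_S chi Sigma S = #|Sigma|%:R :> R[i].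
Proof.
move=> sub; rewrite -sum1_card natr_sum sum_Xmax // [RHS]big_mkcond.
by apply: eq_bigr => S _; rewrite ffunE; case: (_ \in _).
Qed.

Lemma card_Xmax_neq0 : #|X|%:R != 0 :> R[i].
Proof. by rewrite pnatr_eq0 -lt0n; apply/card_gt0P; exists (std_Xmax k). Qed.

Lemma dot_scalel c f h : dot (c *: f) h = c * dot f h.
Proof. by rewrite /dot mulr_sumr; apply: eq_bigr => S _; rewrite ffunE mulrA. Qed.

Lemma dotBl f f' h : dot (f - f') h = dot f h - dot f' h.
Proof. by rewrite dotDl -scaleN1r dot_scalel mulN1r. Qed.

Lemma dotDr f h h' : dot f (h + h') = dot f h + dot f h'.
Proof. by rewrite dotC dotDl !(dotC f). Qed.

Lemma dot_scaler c f h : dot f (c *: h) = c * dot f h.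
Proof. by rewrite dotC dot_scalel dotC. Qed.

Lemma dot_centred Sigma h :
  dot (centred Sigma) h = dot (chi Sigma) h - #|Sigma|%:R / #|X|%:R * \sum_S h S.
Proof. by rewrite dotBl dot_scalel dot_one. Qed.

Lemma dot_centred_one Sigma : Sigma \subset tsing k k -> dot (centred Sigma) cstf1 = 0.
Proof.
move=> sub; rewrite dot_centred dotC dot_one sum_chi // -dot_one.
have -> : dot cstf1 cstf1 = #|X|%:R.
  by rewrite dot_one (eq_bigr (fun=> 1)) ?sumr_const // => S _; rewrite ffunE.
by rewrite divfK ?subrr // card_Xmax_neq0.
Qed.

(** The row sums of the kernel agree by transitivity of the orthogonal group. *)
Lemma kop_one : exists c, kop t cstf1 = c *: cstf1.
Proof.
exists (kop t cstf1 (std_Xmax k)); apply/ffunP => S; rewrite [RHS]ffunE [cstf1 S]ffunE.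
have [g Og gS] := act_transitive S (std_Xmax k).
rewrite -gS; have -> : (kop t cstf1 (act g S) : R[i]) = actf g (kop t cstf1) S.
  by rewrite ffunE.
rewrite -actf_kop // (_ : actf g cstf1 = cstf1); first exact/esym/mulr1.
by apply/ffunP => S'; rewrite !ffunE.
Qed.

Lemma conjf_centred Sigma : conjf (centred Sigma) = centred Sigma.
Proof.
have cE S : centred Sigma S = (val S \in Sigma)%:R - #|Sigma|%:R / #|X|%:R :> R[i].
  by rewrite !ffunE; congr (_ - _); apply: mulr1.
by apply/ffunP => S; rewrite ffunE cE rmorphB fmorph_div /= !conjC_nat.
Qed.

Lemma mean_energyE Sigma : Sigma \subset tsing k k ->
  (mean_energy R t Sigma)%:C%C =
    dot (kop t (chi Sigma)) (chi Sigma) / #|Sigma|%:R ^+ 2.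
Proof.
move=> sub; rewrite /mean_energy fmorph_div rmorphXn /= rmorph_nat; congr (_ / _).
rewrite rmorph_sum sum_Xmax // dotC dot_chi; apply: eq_bigr => S _.
rewrite rmorph_sum sum_Xmax // kopE.
rewrite [RHS](eq_bigr (fun S' => chi Sigma S' * ipow R t S S')) //.
rewrite [LHS]big_mkcond; apply: eq_bigr => S' _; rewrite ffunE rmorph_nat card_cap.
by case: (_ \in _); rewrite ?mul0r // mul1r natrX.
Qed.

Lemma chi_tsing : chi (tsing k k) = cstf1.
Proof. by apply/ffunP => S; rewrite !ffunE (valP S). Qed.

Lemma card_tsing : #|tsing k k| = #|X|.
Proof. by rewrite card_sig; apply: eq_card => S; rewrite !inE. Qed.

(** The cross terms vanish because the constants are eigenvectors orthogonal to [centred Sigma]; the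
    constant part, divided by [#|Sigma|^2], does not depend on [Sigma]. *)
Lemma mean_energy_centred Sigma : Sigma \subset tsing k k -> Sigma != set0 ->
  (mean_energy R t Sigma)%:C%C = (mean_energy R t (tsing k k))%:C%C +
    dot (kop t (centred Sigma)) (conjf (centred Sigma)) / #|Sigma|%:R ^+ 2.
Proof.
move=> sub ne; have s0 : #|Sigma|%:R != 0 :> R[i].
  by rewrite pnatr_eq0 cards_eq0.
have N0 := card_Xmax_neq0; rewrite !mean_energyE // conjf_centred chi_tsing card_tsing.
have [c kc] := kop_one; set b : R[i] := #|Sigma|%:R / #|X|%:R.
have chiE : chi Sigma = centred Sigma + b *: cstf1 by rewrite subrK.
move: (centred Sigma) chiE (dot_centred_one sub) => g chiE g1.
have one1 : dot cstf1 cstf1 = #|X|%:R.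
  by rewrite dot_one (eq_bigr (fun=> 1)) ?sumr_const // => S _; rewrite ffunE.
have kg1 : dot (kop t g) cstf1 = 0 by rewrite dot_kop kc dotC dot_scalel dotC g1 mulr0.
have E : dot (kop t (chi Sigma)) (chi Sigma) = dot (kop t g) g + b * (c * (b * #|X|%:R)).
  have kchi : kop t (chi Sigma) = kop t g + b *: (c *: cstf1).
    by rewrite -kc -linearZ -linearD -chiE.
  rewrite kchi chiE dotDl !dotDr !dot_scalel !dot_scaler.
  by rewrite kg1 (dotC cstf1 g) g1 one1 !mulr0 addr0 add0r.
rewrite E kc dot_scalel one1 mulrDl addrC; congr (_ + _); rewrite /b.
by field; rewrite s0 N0.
Qed.

Lemma centred_lker Sigma : (centred Sigma \in lker (kop t)) <->
  forall h, h \in limg (kop t) -> dot (centred Sigma) h = 0.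
Proof.
split=> [/mem_lker_kop g0 _ /memv_imgP[h _ ->] | g0].
  by rewrite -dot_kop g0 dot0l.
apply/mem_lker_kop/dot_conjf_eq0; rewrite dot_kop -kop_conjf; apply: g0.
by rewrite memv_img ?memvf.
Qed.

(** A function in [limg (kop t)] splits along the [qV j] with [j <= t]. Centring handles the
    constants; for [j > 0] the sum over [Sigma] vanishes by the design property and the sum over
    [X_k] because [qV j] lies in [lker (kop 0)]. *)
Lemma design_centred Sigma : Sigma \subset tsing k k ->
  is_design R t Sigma -> centred Sigma \in lker (kop t).
Proof.
move=> sub des; apply/centred_lker => h ht.
(* The minimum is taken because components exist only up to [k], where the image is already
   everything. *)
have : h \in (\sum_(j < (minn t k).+1) qV R k j)%VS.
  rewrite sum_qV; case: (leqP t k) => // kt.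
  by rewrite limg_kop_top ?memvf.
case/memv_sumP=> hs hq ->; rewrite dotC /dot.
under eq_bigr => S _ do rewrite sum_ffunE mulr_suml.
rewrite exchange_big big1 // => i _.
rewrite -/(dot (hs i) (centred Sigma)) dotC.
have ik : (i < k.+1)%N by rewrite (leq_trans (ltn_ord i)) // ltnS geq_minr.
have it : (i <= t)%N by have := ltn_ord i; rewrite ltnS leq_min => /andP[].
have [i0|i0] := posnP i.
  have := hq i isT; rewrite i0 qV0 => /vlineP[c ->].
  by rewrite dotC dot_scalel dotC dot_centred_one // mulr0.
rewrite dot_centred dot_chi.
have -> := des _ (qV_decomposition R k) (Ordinal ik); rewrite ?i0 ?hq //.
have /memv_capP[_] := hq i isT; case: (nat_of_ord i) i0 => // i' _ hi'.
have /mem_lker_kop/ffunP/(_ (std_Xmax k)) := subvP (lker_kopS R k (leq0n i')) _ hi'.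
rewrite kopE ffunE => e; rewrite (eq_bigr (fun S => hs i S * ipow R 0 (std_Xmax k) S)).
  by rewrite e mulr0 subr0.
by move=> S _; rewrite /ipow expr0 mulr1.
Qed.

(** For an arbitrary decomposition, irreducibility places [V j] inside [limg (kop j)], which
    contains its zonal function, and inside [lker (kop 0)]. *)
Lemma centred_design Sigma : centred Sigma \in lker (kop t) -> is_design R t Sigma.
Proof.
move=> /centred_lker g0 V [[_ _] Virr Viso V0 Vz] j /andP[j0 jt] f fV.
have [Vj0 Vinv Vmin] := Virr j.
have [p sp zp] := Vz j; have [pV p1 _] := zp (std_Xmax k).
have fk : f \in limg (kop t).
  apply: (subvP (limg_kopS R k jt)).
  have [] := Vmin (V j :&: limg (kop j))%VS (capvSl _ _).
  - by apply: invariant_cap => //; apply: invariant_limg_kop.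
  - move=> c0; have : zpoly p (std_Xmax k) \in (V j :&: limg (kop j))%VS.
      by rewrite memv_cap pV zpoly_limg // sp.
    rewrite c0 memv0 => /eqP z0; have := p1; rewrite -/(zpoly _ _) z0 ffunE => /eqP.
    by rewrite eq_sym oner_eq0.
  - by move=> e; move: fV; rewrite -e memv_cap => /andP[].
(* The operator [kop 0] maps [f] to the constant function with value the sum of [f]; if injective on
   [V j], it would identify [V j] with [V ord0]. *)
have sf : \sum_S f S = 0.
  have kop0 h S : kop 0 h S = \sum_S h S.
    by rewrite kopE; apply: eq_bigr => S' _; rewrite /ipow expr0 mulr1.
  have [] := Vmin (V j :&: lker (kop 0))%VS (capvSl _ _).
  - by apply: invariant_cap => //; apply: invariant_lker_kop.
  - move=> c0; case: (Viso j ord0); first by rewrite -val_eqE -lt0n.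
    exists (kop 0); split=> // [|g h Og _]; last exact: actf_kop.
    have sub : (kop 0 @: V j <= V ord0)%VS.
      apply/subvP => _ /memv_imgP[h _ ->]; rewrite V0.
      rewrite (_ : kop 0 h = (\sum_S h S) *: cstf1) ?memvZ ?memv_line //.
      by apply/ffunP => S; rewrite kop0 !ffunE; apply/esym/mulr1.
    apply/eqP; rewrite eqEdim sub V0 dim_vline limg_dim_eq //=.
    by rewrite (leq_trans (leq_b1 _)) // lt0n dimv_eq0; apply/eqP.
  - move=> e; move: fV; rewrite -e memv_cap => /andP[_ /mem_lker_kop/ffunP].
    by move=> /(_ (std_Xmax k)); rewrite kop0 ffunE.
by rewrite -dot_chi; have := g0 f fk; rewrite dot_centred sf mulr0 subr0.
Qed.

End Energy.

Theorem theorem7 (R : realType) (k w t : nat) (hw : (w <= k)%N)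
    (ht : (0 < t)%N) :
  exists d : R,
    (forall Sigma : {set {vspace vec k}},
       Sigma \subset tsing k w -> Sigma != set0 ->
       d <= mean_energy R t Sigma) /\
    (w = k ->
     forall Sigma : {set {vspace vec k}},
       Sigma \subset tsing k k -> Sigma != set0 ->
       (mean_energy R t Sigma = d <-> is_design R t Sigma)).
Proof.
have [ltw|lew] := ltnP w k.
  exists 0; split=> [Sigma _ _|e]; last by move: ltw; rewrite e ltnn.
  rewrite /mean_energy divr_ge0 ?exprn_ge0 ?ler0n //.
  by apply: sumr_ge0 => S _; apply: sumr_ge0 => S' _; rewrite ler0n.
have ewk : w = k by apply/eqP; rewrite eqn_leq hw.
subst w; exists (mean_energy R t (tsing k k)); split=> [Sigma sub ne | _ Sigma sub ne].
  (* The comparison is made in [R[i]], where the excess over the energy of [X_k] is a positive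
     semidefinite form. *)
  rewrite -lecR (mean_energy_centred R t sub ne) lerDl divr_ge0 ?exprn_ge0 ?ler0n //.
  exact: dot_kop_conjf_ge0.
have s0 : (#|Sigma|%:R : R[i]) ^+ 2 != 0 by rewrite expf_eq0 /= pnatr_eq0 cards_eq0.
split=> [e | des].
  apply: centred_design; apply: dot_kop_conjf_eq0; have := mean_energy_centred R t sub ne.
  rewrite e => /eqP; rewrite eq_sym -subr_eq0 addrC addKr mulf_eq0 invr_eq0 (negPf s0).
  by rewrite orbF => /eqP.
have /mem_lker_kop g0 := design_centred sub des.
apply: complexI; rewrite (mean_energy_centred R t sub ne) g0 dot0l.
by rewrite mul0r addr0.
Qed.
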